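(* The minimum degree of each minimally $1$-tough $(K_1\cup P_4)$-free graph is $2$.
   Context: All graphs are simple and finite. $P_n$ denotes the path on $n$ vertices, and $K_1$ is the one-vertex graph. $H_1\cup H_2$ denotes the union of two vertex-disjoint graphs $H_1$ and $H_2$ (with no edges between them), so $K_1\cup P_4$ is the disjoint union of an isolated vertex and a path on four vertices. A graph $G$ is $H$-free if it contains no induced subgraph isomorphic to $H$. Let $\omega(G)$ denote the number of components of $G$. A vertex subset $S$ of $G$ is a vertex cut if $G-S$ is disconnected. For a real number $t\ge 0$, $G$ is $t$-tough if $|S|\ge t\cdot\omega(G-S)$ for every vertex cut $S$ of $G$. The toughness $\tau(G)$ is the maximum $t$ such that $G$ is $t$-tough if $G$ is non-complete, and $\tau(G)=+\infty$ if $G$ is complete. For a positive real number $t$, $G$ is minimally $t$-tough if $\tau(G)=t$ and $\tau(G-e)<t$ for each edge $e$ of $G$, where $G-e$ is $G$ with the edge $e$ deleted. *)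

(* Defs.v *)
From mathcomp Require Import all_boot all_order all_algebra.

Set Implicit Arguments.
Unset Strict Implicit.
Unset Printing Implicit Defensive.

Import Order.TTheory GRing.Theory Num.Theory.

Record sgraph := SGraph {
  vertex :> finType;
  adj : rel vertex;
  adj_sym : symmetric adj;
  adj_irr : irreflexive adj }.

Arguments adj {s}.

Section Basic.
Variable G : sgraph.
Implicit Types (A S : {set G}) (u v : G).

Lemma induced_sym A :
  symmetric (fun x y : {x : G | x \in A} => adj (val x) (val y)).
Proof. by move=> x y; exact: adj_sym. Qed.

Lemma induced_irr A :
  irreflexive (fun x y : {x : G | x \in A} => adj (val x) (val y)).
Proof. by move=> x; exact: adj_irr. Qed.

Definition induced A := SGraph (@induced_sym A) (@induced_irr A).

Definition del_vertices S := induced (~: S).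

Definition del_edge_rel u v : rel G :=
  fun x y => adj x y && ([set x; y] != [set u; v]).

Lemma del_edge_sym u v : symmetric (del_edge_rel u v).
Proof. by move=> x y; rewrite /del_edge_rel adj_sym setUC. Qed.

Lemma del_edge_irr u v : irreflexive (del_edge_rel u v).
Proof. by move=> x; rewrite /del_edge_rel adj_irr. Qed.

Definition del_edge u v := SGraph (@del_edge_sym u v) (@del_edge_irr u v).

Definition complete := [forall x : G, forall y : G, (x != y) ==> adj x y].

Definition connected := [forall x : G, forall y : G, connect adj x y].

Definition ncomponents := n_comp (@adj G) predT.

Definition degree v := #|[set w | adj v w]|.

(* Every degree is below #|G|, so the initial value #|G| never matters for a
   graph with at least one vertex. *)
Definition min_degree := \big[minn/#|G|]_(v : G) degree v.

End Basic.

Definition vertex_cut (G : sgraph) (S : {set G}) :=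
  ~~ connected (del_vertices S).

Definition iso (G H : sgraph) :=
  exists f : G -> H, bijective f /\ forall x y, adj (f x) (f y) = adj x y.

Definition induced_free (H G : sgraph) := forall A : {set G}, ~ iso (induced A) H.

Definition path_rel n : rel 'I_n := fun i j => (i.+1 == j) || (j.+1 == i).

Lemma path_sym n : symmetric (@path_rel n).
Proof. by move=> i j; rewrite /path_rel orbC. Qed.

Lemma path_irr n : irreflexive (@path_rel n).
Proof. by move=> i; rewrite /path_rel orbb gtn_eqF. Qed.

Definition path_graph n := SGraph (@path_sym n) (@path_irr n).

Definition complete_rel n : rel 'I_n := fun i j => i != j.

Lemma complete_sym n : symmetric (@complete_rel n).
Proof. by move=> i j; rewrite /complete_rel eq_sym. Qed.

Lemma complete_irr n : irreflexive (@complete_rel n).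
Proof. by move=> i; rewrite /complete_rel eqxx. Qed.

Definition complete_graph n := SGraph (@complete_sym n) (@complete_irr n).

Definition union_rel (G H : sgraph) : rel (G + H)%type := fun x y =>
  match x, y with
  | inl a, inl b => adj a b
  | inr a, inr b => adj a b
  | _, _ => false
  end.

Lemma union_sym G H : symmetric (@union_rel G H).
Proof. by move=> [a|a] [b|b] //=; exact: adj_sym. Qed.

Lemma union_irr G H : irreflexive (@union_rel G H).
Proof. by move=> [a|a] /=; exact: adj_irr. Qed.

Definition disjoint_union G H := SGraph (@union_sym G H) (@union_irr G H).

Section MinDegree.
Variable G : sgraph.

Lemma degree_lt_card (v : G) : degree v < #|G|.
Proof.
rewrite -cardsT; apply: proper_card; apply/properP; split; first exact: subsetT.
by exists v; rewrite ?inE ?adj_irr.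
Qed.

Lemma min_degree_le (v : G) : min_degree G <= degree v.
Proof.
rewrite /min_degree; elim: (index_enum _) (mem_index_enum v) => // w s IHs.
rewrite in_cons big_cons geq_min => /orP[/eqP <-|/IHs ->]; first by rewrite leqnn.
by rewrite orbT.
Qed.

Lemma min_degree_attained (v0 : G) : exists v : G, degree v = min_degree G.
Proof.
have [v _ vmin] := arg_minnP (P := xpredT) (@degree G) (erefl (xpredT v0)).
exists v; apply/eqP; rewrite eqn_leq min_degree_le andbT /min_degree.
elim/big_ind: _ => [|a b ha hb|w _]; last exact: vmin.
  exact: ltnW (degree_lt_card v).
by rewrite leq_min ha hb.
Qed.

End MinDegree.

From mathcomp Require Import boolp classical_sets reals constructive_ereal ereal.

Local Open Scope classical_set_scope.
Local Open Scope ring_scope.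

Section Toughness.
Variables (R : realType) (G : sgraph).

Definition tough (t : R) := forall S : {set G}, vertex_cut S ->
  t * (ncomponents (del_vertices S))%:R <= #|S|%:R.

(* For a non-complete graph the supremum is a maximum, by
   toughness_attained below. *)
Definition toughness : \bar R :=
  if complete G then +oo%E
  else ereal_sup [set t%:E | t in [set t : R | 0 <= t /\ tough t]].

Lemma ncomponents_gt0 (H : sgraph) (x : H) : (0 < ncomponents H)%N.
Proof.
have sym : connect_sym (@adj H) by apply: sym_connect_sym; exact: adj_sym.
by apply/card_gt0P; exists (fingraph.root adj x); rewrite !inE andbT roots_root.
Qed.

Lemma vertex_cut_ncomponents_gt0 (S : {set G}) :
  vertex_cut S -> (0 < ncomponents (del_vertices S))%N.
Proof.
by rewrite /vertex_cut negb_forall => /existsP[x _]; exact: ncomponents_gt0 x.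
Qed.

Lemma vertex_cut_exists :
  ~~ complete G -> exists S : {set G}, vertex_cut S.
Proof.
rewrite negb_forall => /existsP[x]; rewrite negb_forall => /existsP[y].
rewrite negb_imply => /andP[xy nxy]; exists (~: [set x; y]%SET).
have Px : x \in ~: ~: [set x; y]%SET by rewrite !inE eqxx.
have Py : y \in ~: ~: [set x; y]%SET by rewrite !inE eqxx orbT.
rewrite /vertex_cut negb_forall; apply/existsP; exists (Sub x Px).
rewrite negb_forall; apply/existsP; exists (Sub y Py).
apply/connectP => -[[|z p] /= ].
  by move=> _ /(congr1 val)/= yx; rewrite yx eqxx in xy.
case/andP => + _ _; case: z => z /= Pz.
move: Pz; rewrite finset.setCK !inE => /orP[] /eqP ->; first by rewrite adj_irr.
by rewrite (negbTE nxy).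
Qed.

Lemma toughness_attained : ~~ complete G ->
  exists t : R, [/\ toughness = t%:E, 0 <= t, tough t &
    forall s : R, 0 <= s -> tough s -> s <= t].
Proof.
move=> ncG; have [S0 cutS0] := vertex_cut_exists ncG.
pose F (S : {set G}) : R := #|S|%:R / (ncomponents (del_vertices S))%:R.
have [S cutS minS] := Order.TotalTheory.arg_minP F cutS0.
have F0 : 0 <= F S by rewrite divr_ge0.
have toughF : tough (F S).
  move=> S' cutS'; rewrite -ler_pdivlMr ?minS //.
  by rewrite ltr0n vertex_cut_ncomponents_gt0.
have maxF (s : R) : 0 <= s -> tough s -> s <= F S.
  move=> _ /(_ S cutS); rewrite -ler_pdivlMr //.
  by rewrite ltr0n vertex_cut_ncomponents_gt0.
exists (F S); split => //; rewrite /toughness (negbTE ncG).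
apply/eqP; rewrite eq_le; apply/andP; split.
  by apply: ge_ereal_sup => _ [s [s0 ts] <-]; rewrite lee_fin maxF.
by apply: ereal_sup_ubound; exists (F S).
Qed.

End Toughness.

Definition minimally_tough (R : realType) (t : R) (G : sgraph) :=
  toughness R G = t%:E /\
  forall u v : G, adj u v -> (toughness R (del_edge u v) < t%:E)%E.

(* Main.v *)
Require Import Defs.
From mathcomp Require Import all_boot all_order all_algebra reals constructive_ereal.
From mathcomp Require Import zify.

(** Degrees are at least 2 because a vertex of smaller degree is cut off by its
    neighbourhood.  For the converse, suppose that all degrees are at least 3.
    No Hamiltonian cycle is constructed; the contradiction comes from sets that
    meet the toughness bound with equality.

    Call S tight if G - S has exactly |S| >= 2 components.  Merging what a
    proper part A of S touches shows that A touches more than |A| components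
    ([tight_touched]).  Deleting an edge destroys 1-toughness, so every edge is
    a bridge inside one component of G - S for some nonempty S with exactly |S|
    components ([edge_bridge_cut]).  The case |S| = 1 is impossible
    ([singleton_cut_absurd]).  Hence S is tight; there is a second component,
    so the one with the bridge has no induced P4, and this forces one end x of
    the bridge to be a leaf of the component {x, t} + E while the other end t
    is adjacent to all of E ([edge_leaf_cut]).  A pattern used all the time: if
    c in S is adjacent to t and not to x, the paths x - t - c - l make c
    adjacent to everything beyond that component ([complete_far]).

    Some vertex x is isolated by a tight set: otherwise E is always empty, and
    comparing the tight sets of two edges at x, the first of maximal size,
    makes the second one larger ([tight_isolated_exists]).  When x is isolated
    by M, it is the leaf for every edge at x ([isolated_dominator]).  Take M of
    maximal size.  Counting components ([no_complete_outside]) shows that, for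
    the cut of an edge xt, the neighbours of t outside M are x and vertices of
    E, and those of E outside M belong to E.  So the components of G - M met by E number
    at most one more than the vertices of E in M, whereas tightness demands
    that sets touch many components.  The two bounds make the components seen
    by different neighbours of x disjoint ([inner_disjoint]).  Three neighbours
    of x, each with a private neighbour, then induce a K1 + P4. *)

Set Implicit Arguments.
Unset Strict Implicit.
Unset Printing Implicit Defensive.

Import Order.TTheory GRing.Theory Num.Theory.

(** * Components as minimal islands *)

Section Islands.
Variables (V : finType) (adj : rel V).
Implicit Types (S T P Q X D : {set V}) (F : {set {set V}}) (x y : V).

(** A nonempty union of components of the graph minus S.  Stating toughness for
    families of disjoint islands avoids any reasoning about paths. *)
Definition island S P :=
  [&& P != set0, [disjoint P & S] &
      [forall x in P, forall y, adj x y ==> (y \in P :|: S)]].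

Lemma islandP S P : reflect
  [/\ exists x, x \in P, forall x, x \in P -> x \notin S
    & forall x y, x \in P -> adj x y -> y \notin S -> y \in P]
  (island S P).
Proof.
apply: (iffP and3P) => [[/set0Pn Pn0 dis /forall_inP cl]|[Pn0 dis cl]].
  split=> // [x xP|x y xP xy yS]; first by rewrite (disjointFr dis xP).
  by move/forallP/(_ y): (cl x xP); rewrite xy inE (negbTE yS) orbF.
split; first exact/set0Pn.
  by rewrite disjoint_subset; apply/subsetP => x /dis; rewrite inE.
apply/forall_inP => x xP; apply/forallP => y; apply/implyP => xy.
by rewrite inE; case: (boolP (y \in S)); rewrite ?orbT // orbF; apply: cl xP xy.
Qed.

(** Locked so that rewriting with the membership rules of finite sets stops at
    [comps] instead of exposing minimality. *)
Definition comps S := locked [set D | minset (island S) D].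

Lemma compsE S D : (D \in comps S) = minset (island S) D.
Proof. by rewrite /comps -lock inE. Qed.

Lemma comps_island S D : D \in comps S -> island S D.
Proof. by rewrite compsE => /minsetp. Qed.

Lemma comps_notin S D x : D \in comps S -> x \in D -> x \notin S.
Proof. by move/comps_island/islandP => [_ + _]; apply. Qed.

Lemma comps_n0 S D : D \in comps S -> exists x, x \in D.
Proof. by move/comps_island/islandP => []. Qed.

Lemma comps_adj S D x y :
  D \in comps S -> x \in D -> adj x y -> y \notin S -> y \in D.
Proof. by move/comps_island/islandP => [_ _]; apply. Qed.

Lemma comps_adjS S D x y :
  D \in comps S -> x \in D -> adj x y -> y \notin D -> y \in S.
Proof. by move=> Dc xD xy; apply: contraNT; apply: (comps_adj Dc xD xy). Qed.

Lemma island_comp S P : island S P -> exists2 D, D \in comps S & D \subset P.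
Proof. by move/minset_exists => [D mD DP]; exists D; rewrite ?compsE. Qed.

(** Connectedness in the form in which it is applied: a set that meets A and is
    closed under adjacency within A swallows A. *)
Definition conn (A : {set V}) := forall X, (exists2 x, x \in A & x \in X) ->
  (forall x y, x \in A -> x \in X -> y \in A -> adj x y -> y \in X) ->
  A \subset X.

Lemma comps_conn S D : D \in comps S -> conn D.
Proof.
move=> Dc X [x xD xX] cl; have [_ DS Dcl] := islandP _ _ (comps_island Dc).
have isl : island S (D :&: X).
  apply/islandP; split=> [|y|y z]; first by exists x; rewrite inE xD.
    by case/setIP => /DS.
  case/setIP => yD yX yz zS; have zD := Dcl _ _ yD yz zS.
  by rewrite inE zD (cl y).
move: Dc; rewrite compsE => /minsetP[_ /(_ _ isl (subsetIl _ _)) <-].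
exact: subsetIr.
Qed.

Lemma comps_sub S D X : D \in comps S -> (exists2 x, x \in D & x \in X) ->
  (forall x y, x \in X -> adj x y -> y \in D -> y \in X) -> D \subset X.
Proof. by move=> /comps_conn cD nz cl; apply: cD => // x y _ xX yD /cl; apply. Qed.

Lemma comps_eq S D D' x :
  D \in comps S -> D' \in comps S -> x \in D -> x \in D' -> D = D'.
Proof.
suff sub E E' : E \in comps S -> E' \in comps S -> x \in E -> x \in E' ->
    E \subset E'.
  by move=> c c' xD xD'; apply/eqP; rewrite eqEsubset !sub.
move=> c c' xE xE'; apply: (comps_sub c) => [|y z yE' yz zE]; first by exists x.
exact: comps_adj c' yE' yz (comps_notin c zE).
Qed.

Lemma comps_adj_eq S D D' x y : D \in comps S -> D' \in comps S ->
  x \in D -> y \in D' -> adj x y -> D = D'.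
Proof.
move=> c c' xD yD' xy; apply: (comps_eq c c' _ yD') => //.
exact: comps_adj c xD xy (comps_notin c' yD').
Qed.

(** By symmetry the vertices outside S and outside all components would form an
    island, which contains a component. *)
Lemma comps_cover S x : symmetric adj -> x \notin S -> exists2 D, D \in comps S & x \in D.
Proof.
move=> adj_sym xS; case: (boolP (x \in cover (comps S))).
  by case/bigcupP => D; exists D.
move=> xU; suff /island_comp[D Dc] : island S (~: (cover (comps S) :|: S)).
  have [y yD] := comps_n0 Dc => /subsetP /(_ y yD); rewrite !inE negb_or.
  by case/andP => /bigcupP[]; exists D.
apply/islandP; split=> [|y|y z].
- by exists x; rewrite !inE negb_or xU.
- by rewrite !inE negb_or => /andP[].
rewrite !inE !negb_or => /andP[/bigcupP yU yS] yz zS; rewrite zS andbT.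
apply/bigcupP => -[D Dc zD]; case: yU; exists D => //.
by apply: (comps_adj Dc zD _ yS); rewrite adj_sym.
Qed.

(** Disjoint islands contain distinct components. *)
Lemma card_islands S F : (forall P, P \in F -> island S P) ->
  (forall P Q x, P \in F -> Q \in F -> x \in P -> x \in Q -> P = Q) ->
  #|F| <= #|comps S|.
Proof.
move=> isl dis; pose f P := odflt set0 [pick D in comps S | D \subset P].
have fP P : P \in F -> f P \in comps S /\ f P \subset P.
  move=> PF; rewrite /f; case: pickP => [D /andP[] //|no].
  by have [D Dc DP] := island_comp (isl _ PF); move: (no D); rewrite Dc DP.
have inj : {in F &, injective f}; last first.
  rewrite -(card_in_imset inj); apply: subset_leq_card.
  by apply/subsetP => _ /imsetP[P /fP[? _] ->].
move=> P Q PF QF fPQ.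
have [c /subsetP sP] := fP _ PF; have [_ /subsetP sQ] := fP _ QF.
by have [x xf] := comps_n0 c; apply: (dis P Q x) => //; [apply: sP|apply: sQ; rewrite -fPQ].
Qed.

Lemma card_hit S F X : F \subset comps S ->
  (forall D, D \in F -> exists2 x, x \in D & x \in X) -> #|F| <= #|X|.
Proof.
move=> /subsetP sF hit; have [->|[D0 D0F]] := set_0Vmem F; first by rewrite cards0.
have [x0 _ _] := hit _ D0F; pose f D := odflt x0 [pick x in D | x \in X].
have fP D : D \in F -> f D \in D /\ f D \in X.
  move=> DF; rewrite /f; case: pickP => [x /andP[] //|no].
  by have [x xD xX] := hit _ DF; move: (no x); rewrite xD xX.
have inj : {in F &, injective f}; last first.
  rewrite -(card_in_imset inj); apply: subset_leq_card.
  by apply/subsetP => _ /imsetP[D /fP[_ ?] ->].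
move=> D D' DF D'F fDD'.
have [fD _] := fP _ DF; have [fD' _] := fP _ D'F.
by apply: (comps_eq (sF _ DF) (sF _ D'F) fD _); rewrite fDD'.
Qed.

End Islands.

(** * The component count of the definitions *)

Section Count.
Variables (G : sgraph).
Implicit Types (X D : {set G}) (x y : G).
Variable S : {set G}.
Let H := del_vertices S.

Let vl (y : H) : G := sval y.
Let pt (y : G) (yS : y \in ~: S) : H := exist _ y yS.

Definition reach (r : H) : {set G} := [set vl y | y in connect adj r].

Let symH : connect_sym (@adj H).
Proof. by apply: sym_connect_sym; exact: adj_sym. Qed.

Lemma mem_reach (r y : H) : (vl y \in reach r) = connect adj r y.
Proof. by rewrite /reach (mem_imset _ _ val_inj). Qed.

Lemma reach_comps r : reach r \in comps adj S.
Proof.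
have isl : island adj S (reach r).
  apply/islandP; split=> [|x|x y].
  - by exists (vl r); rewrite mem_reach connect0.
  - by case/imsetP => y _ ->; have := valP y; rewrite inE.
  - case/imsetP => z rz -> zy yS; have yS' : y \in ~: S by rewrite inE.
    rewrite -[y]/(vl (pt yS')) mem_reach.
    by apply: (connect_trans rz _); apply: connect1.
rewrite compsE; apply/minsetP; split=> // X /islandP[[x xX] _ clX] sX.
apply/eqP; rewrite eqEsubset sX; apply/subsetP => _ /imsetP[z rz ->].
have /imsetP[y ry xy] := subsetP sX _ xX.
have cl : closed (@adj H) [pred w | vl w \in X].
  apply: (intro_closed symH _) => a b ab aX.
  by apply: (clX _ _ aX ab); have := valP b; rewrite inE.
have : connect adj y z by apply: (connect_trans _ rz); rewrite symH.
by move/(closed_connect cl); rewrite !inE -xy xX.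
Qed.

Lemma card_comps : #|comps adj S| = ncomponents H.
Proof.
have -> : comps adj S = [set reach r | r in roots (@adj H)].
  apply/setP => D; apply/idP/imsetP => [Dc|[r _ ->]]; last exact: reach_comps.
  have [x xD] := comps_n0 Dc.
  have xS : x \in ~: S by rewrite inE (comps_notin Dc).
  exists (fingraph.root adj (pt xS)); first exact: roots_root.
  apply: (comps_eq Dc (reach_comps _) xD _).
  by rewrite -[x]/(vl (pt xS)) mem_reach symH connect_root.
rewrite card_in_imset; last first.
  move=> r r' rr rr' e; move: (connect0 adj r'); rewrite -mem_reach -e mem_reach.
  by move/(fingraph.rootP symH); move/eqP: rr; move/eqP: rr' => -> ->.
by apply: eq_card => r; rewrite !inE andbT.
Qed.

Lemma connected_comps : ~~ connected H = (1 < #|comps adj S|).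
Proof.
apply/idP/card_gt1P => [|[D [D' [Dc D'c]]]].
  rewrite negb_forall => /existsP[x]; rewrite negb_forall => /existsP[y nxy].
  exists (reach x), (reach y); split; try exact: reach_comps.
  by apply: contraNneq nxy => e; rewrite -mem_reach e mem_reach connect0.
apply: contraNN => /forallP con.
have [x xD] := comps_n0 Dc; have [y yD'] := comps_n0 D'c.
have xS : x \in ~: S by rewrite inE (comps_notin Dc).
have yS : y \in ~: S by rewrite inE (comps_notin D'c).
have eD : D = reach (pt xS).
  by apply: (comps_eq Dc (reach_comps _) xD _); rewrite -[x]/(vl (pt xS)) mem_reach connect0.
rewrite eD; apply/eqP; apply: (comps_eq (reach_comps _) D'c _ yD').
by rewrite -[y]/(vl (pt yS)) mem_reach (forallP (con _)).
Qed.

End Count.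

(** * The forbidden subgraph *)

Section Pattern.
Variable G : sgraph.

Lemma induced_iso (K : sgraph) (g : K -> G) :
  injective g -> (forall x y, adj (g x) (g y) = adj x y) ->
  iso (induced [set g x | x in K]) K.
Proof.
move=> inj_g adj_g; set A := [set g x | x in K].
have gA x : g x \in A by apply: imset_f.
pose g' x : induced A := exist _ (g x) (gA x).
have pre (y : induced A) : exists x, g x == sval y.
  by case: y => y /= /imsetP[x _ ->]; exists x.
pose f y := xchoose (pre y).
have fK : cancel f g' by move=> y; apply: val_inj; apply/eqP/(xchooseP (pre y)).
have gK : cancel g' f by move=> x; apply: inj_g; apply/eqP/(xchooseP (pre (g' x))).
exists f; split=> [|x y]; first by exists g'.
by rewrite -adj_g -[in RHS](fK x) -[in RHS](fK y).
Qed.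

(** The form in which (K1 + P4)-freeness is used.  The non-adjacencies already
    force the five vertices to be distinct. *)
Lemma dominated_P4 (z a b c d : G) :
  induced_free (disjoint_union (complete_graph 1) (path_graph 4)) G ->
  adj a b -> adj b c -> adj c d -> ~~ adj a c -> ~~ adj a d -> ~~ adj b d ->
  [|| adj z a, adj z b, adj z c | adj z d].
Proof.
move=> free ab bc cd ac ad bd; apply: contraT; rewrite !negb_or.
case/and4P => za zb zc zd; pose K := disjoint_union (complete_graph 1) (path_graph 4).
pose g (x : K) : G := match x with inl _ => z | inr i => nth z [:: a; b; c; d] (val i) end.
pose E := (adj_irr, ab, bc, cd, negbTE ac, negbTE ad, negbTE bd,
  negbTE za, negbTE zb, negbTE zc, negbTE zd).
pose E' := (E, adj_sym b a, adj_sym c a, adj_sym c b, adj_sym d a, adj_sym d b,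
  adj_sym d c, adj_sym a z, adj_sym b z, adj_sym c z, adj_sym d z).
have adj_g x y : adj (g x) (g y) = adj x y.
  case: x y => [x|[[|[|[|[|//]]]] ?]] [y|[[|[|[|[|//]]]] ?]]; rewrite /= ?E' //.
  by rewrite [x]ord1 [y]ord1.
case: (free [set g x | x in K]); apply: induced_iso => // x y gxy.
have key w : adj x w = adj y w by rewrite -!adj_g gxy.
move: (key (inr (inord 0))) (key (inr (inord 1))) (key (inr (inord 2))) (key (inr (inord 3))).
clear; case: x y => [x|[[|[|[|[|//]]]] ?]] [y|[[|[|[|[|//]]]] ?]];
  rewrite /= /path_rel /= ?inordK //= => *; rewrite ?[x]ord1 ?[y]ord1 //.
all: by congr inr; apply: val_inj.
Qed.
End Pattern.

(** * Tight sets *)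

(** Generalizing the cardinals first keeps the preprocessing of [lia] from
    exploring the set expressions and the context. *)
Ltac cardlia := repeat match goal with
  | |- context [card ?m] => let n := fresh "n" in set n := (card m); clearbody n
  end; clear; lia.

Lemma cardsU_disjoint (V : finType) (A B : {set V}) :
  (forall y, y \in A -> y \notin B) -> #|A :|: B| = #|A| + #|B|.
Proof.
move=> dis; rewrite cardsU (_ : A :&: B = set0) ?cards0 ?subn0 //.
apply/setP => y; rewrite inE in_set0; apply/negP => /andP[/dis yB yB'].
by rewrite yB' in yB.
Qed.

Section Core.
Variable G : sgraph.
Implicit Types (S T M A B C D E X Z : {set G}) (F : {set {set G}}) (a b c u v w x y z t s : G).

(** A counterexample: 1-tough, with every induced P4 dominating, of minimum
    degree at least 3, and with every edge critical. *)
Hypothesis tough1 : forall S, 1 < #|comps adj S| -> #|comps adj S| <= #|S|.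
Hypothesis domP4 : forall z a b c d : G,
  adj a b -> adj b c -> adj c d -> ~~ adj a c -> ~~ adj a d -> ~~ adj b d ->
  [|| adj z a, adj z b, adj z c | adj z d].
Hypothesis deg3 : forall v, 2 < degree v.
Hypothesis critical : forall u v, adj u v -> exists S,
  1 < #|comps (del_edge_rel u v) S| /\ #|S| < #|comps (del_edge_rel u v) S|.

Lemma adjC x y : adj x y -> adj y x. Proof. by rewrite adj_sym. Qed.

Lemma adj_neq x y : adj x y -> x != y.
Proof. by apply: contraTneq => ->; rewrite adj_irr. Qed.

(** Minimum degree 3 is used through this: two forbidden vertices still leave a
    neighbour. *)
Lemma third_neighbour v X : #|X| <= 2 -> exists2 w, adj v w & w \notin X.
Proof.
move=> X2; have /set0Pn[w] : [set w | adj v w] :\: X != set0.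
  by apply: contraTneq (deg3 v) => /eqP; rewrite setD_eq0 -leqNgt => /subset_leq_card/leq_trans->.
by rewrite !inE => /andP[wX vw]; exists w.
Qed.

Definition packing S F := (forall P, P \in F -> island adj S P) /\
  (forall P Q x, P \in F -> Q \in F -> x \in P -> x \in Q -> P = Q).

Lemma packing_tough S F : packing S F -> 1 < #|F| -> #|F| <= #|S|.
Proof.
case=> isl dis F1; have le := card_islands isl dis.
exact: leq_trans le (tough1 (leq_trans F1 le)).
Qed.

Lemma comps_packing S T F : F \subset comps adj T -> T \subset S ->
  (forall D x, D \in F -> x \in D -> x \notin S) -> packing S F.
Proof.
move=> /subsetP sF /subsetP sT FS; split=> [P PF|P Q x PF QF]; last first.
  exact: comps_eq (sF _ PF) (sF _ QF).
apply/islandP; split=> [|x|x y xP xy yS]; first exact: comps_n0 (sF _ PF).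
  exact: FS.
by apply: comps_adj (sF _ PF) xP xy _; apply: contra yS => /sT.
Qed.

Lemma packing1 S F P : packing S F -> island adj S P ->
  (forall Q x, Q \in F -> x \in P -> x \notin Q) ->
  packing S (P |: F) /\ #|P |: F| = #|F|.+1.
Proof.
move=> [iF dF] iP dP; split; last first.
  rewrite cardsU1 (_ : P \notin F) //; apply/negP => PF.
  by have [[x xP] _ _] := islandP _ _ _ iP; move: (dP _ _ PF xP); rewrite xP.
split=> [Q /setU1P[->|/iF]|Q Q' x] //.
case/setU1P => [->|QF] /setU1P[->|Q'F] // xQ xQ'.
- by move: (dP _ _ Q'F xQ); rewrite xQ'.
- by move: (dP _ _ QF xQ'); rewrite xQ.
exact: dF xQ xQ'.
Qed.

Lemma packingU S F F' : packing S F -> packing S F' ->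
  (forall P Q x, P \in F -> Q \in F' -> x \in P -> x \notin Q) ->
  packing S (F :|: F') /\ #|F :|: F'| = #|F| + #|F'|.
Proof.
move=> [iF dF] [iF' dF'] cross; split; last first.
  rewrite cardsU (_ : F :&: F' = set0) ?cards0 ?subn0 //; apply/setP => P.
  rewrite !inE; apply/negP => /andP[PF PF']; have [[x xP] _ _] := islandP _ _ _ (iF _ PF).
  by move: (cross _ _ _ PF PF' xP); rewrite xP.
split=> [P /setUP[/iF|/iF']|P Q x] // /setUP[PF|PF] /setUP[QF|QF].
- exact: dF.
- by move=> xP xQ; move: (cross _ _ _ PF QF xP); rewrite xQ.
- by move=> xP xQ; move: (cross _ _ _ QF PF xQ); rewrite xP.
exact: dF'.
Qed.

Lemma two_islands S A B a b : island adj S A -> island adj S B ->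
  a \in A -> b \in B -> (forall x, x \in A -> x \notin B) -> 1 < #|S|.
Proof.
move=> iA iB aA bB dis.
have pB : packing S [set B] by split=> [P /set1P ->|P Q x /set1P -> /set1P ->].
have [p c] : packing S (A |: [set B]) /\ #|A |: [set B]| = #|[set B]|.+1.
  by apply: packing1 => // Q x /set1P ->; apply: dis.
by have := packing_tough p; rewrite c cards1; apply.
Qed.

Lemma other_comp S Z D y : Z \in comps adj S -> D \in comps adj S :\ Z ->
  y \in D -> y \notin Z.
Proof.
move=> Zc /setD1P[DZ Dc] yD; apply: contra DZ => yZ; apply/eqP.
exact: comps_eq Dc Zc yD yZ.
Qed.

Definition tight S := (1 < #|S|) && (#|comps adj S| == #|S|).

Lemma tight_gt1 S : tight S -> 1 < #|S|. Proof. by case/andP. Qed.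
Lemma tight_card S : tight S -> #|comps adj S| = #|S|. Proof. by case/andP => _ /eqP. Qed.

Definition touched S A :=
  [set D in comps adj S | [exists x in D, exists y in A, adj y x]].

Lemma touchedP S A D : reflect
  (D \in comps adj S /\ exists x y, [/\ x \in D, y \in A & adj y x]) (D \in touched S A).
Proof.
rewrite inE; apply: (iffP andP) => -[Dc].
  by case/exists_inP => x xD /exists_inP[y yA yx]; split=> //; exists x, y.
case=> x [y [xD yA yx]]; split=> //; apply/exists_inP; exists x => //.
by apply/exists_inP; exists y.
Qed.

(** The components not touched by A, together with the merger of A and all the
    touched ones, are islands of S minus A; toughness bounds their number by
    |S| - |A|. *)
Lemma tight_touched S A : tight S -> A != set0 -> A \proper S ->
  #|A| < #|touched S A|.
Proof.
move=> tS A0 /andP[AS nSA]; set U := comps adj S :\: touched S A.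
have cardU : #|touched S A| + #|U| = #|S|.
  rewrite -(tight_card tS) -(cardsID (touched S A) (comps adj S)); congr (_ + _).
  by apply: eq_card => D; rewrite !inE; case: (D \in comps adj S); rewrite ?andbF ?andbT.
have ltA : #|A| < #|S| by apply: proper_card; rewrite /proper AS.
have [U0|U0] := eqVneq U set0; first by move: cardU; rewrite U0 cards0 addn0 => ->.
have UP D : D \in U -> D \in comps adj S /\ forall x y, x \in D -> y \in A -> ~~ adj x y.
  rewrite inE => /andP[nt Dc]; split=> // x y xD yA; apply: contra nt => xy.
  by apply/touchedP; split=> //; exists x, y; rewrite adj_sym.
have pU : packing (S :\: A) U.
  split=> [P /UP[Pc nA]|P Q x /UP[Pc _] /UP[Qc _]]; last exact: comps_eq Pc Qc.
  apply/islandP; split=> [|x xP|x y xP xy]; first exact: comps_n0 Pc.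
    by rewrite inE (negbTE (comps_notin Pc xP)) andbF.
  rewrite inE negb_and negbK => /orP[yA|]; last exact: comps_adj Pc xP xy.
  by have := nA _ _ xP yA; rewrite xy.
pose W := A :|: cover (touched S A).
have iW : island adj (S :\: A) W.
  apply/islandP; split=> [|x|x y].
  - by have /set0Pn[x xA] := A0; exists x; rewrite inE xA.
  - rewrite !inE => /orP[-> //|/bigcupP[D /touchedP[Dc _] xD]].
    by rewrite (negbTE (comps_notin Dc xD)) andbF.
  rewrite !inE negb_and negbK => xW xy /orP[-> //|yS]; apply/orP; right.
  case/orP: xW => [xA|/bigcupP[D Dt xD]].
    have [D Dc yD] := comps_cover (@adj_sym G) yS; apply/bigcupP; exists D => //.
    by apply/touchedP; split=> //; exists y, x.
  apply/bigcupP; exists D => //; have [Dc _] := touchedP _ _ _ Dt.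
  exact: comps_adj Dc xD xy yS.
have [|pW cW] := packing1 pU iW.
  move=> D x DU xW; have [Dc _] := UP _ DU; apply/negP => xD.
  move: xW; rewrite inE => /orP[/(subsetP AS)|/bigcupP[D' D't xD']].
    by rewrite (negbTE (comps_notin Dc xD)).
  have [D'c _] := touchedP _ _ _ D't.
  by move: DU; rewrite (comps_eq Dc D'c xD xD') inE D't.
have := packing_tough pW; rewrite cW ltnS card_gt0 => /(_ U0).
have := cardsID A S; rewrite (setIidPr AS).
by move: cardU ltA; cardlia.
Qed.

Lemma touch_other T Z c : tight T -> c \in T -> Z \in comps adj T ->
  exists2 l, adj c l & (l \notin T) && (l \notin Z).
Proof.
move=> tT cT Zc; have := tight_touched (A := [set c]) tT.
have c0 : [set c] != set0 by apply/set0Pn; exists c; rewrite inE.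
have cp : [set c] \proper T.
  rewrite properE sub1set cT /=; apply: contraTN (tight_gt1 tT).
  by move/subset_leq_card; rewrite cards1 -leqNgt.
move=> /(_ c0 cp); rewrite cards1 => /card_gt1P[D [D' [/touchedP[Dc h] /touchedP[D'c h'] DD']]].
have [DZ|DZ] := eqVneq D Z.
  case: h' => l [_ [lD' /set1P -> cl]]; exists l => //; rewrite (comps_notin D'c) //=.
  by apply: contra DD' => lZ; rewrite DZ; apply/eqP; apply: (comps_eq Zc D'c lZ lD').
case: h => l [_ [lD /set1P -> cl]]; exists l => //; rewrite (comps_notin Dc) //=.
by apply: contra DZ => lZ; apply/eqP; apply: (comps_eq Dc Zc lD lZ).
Qed.

Lemma comps_nadj S D x y : D \in comps adj S -> x \in D -> y \notin S -> y \notin D ->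
  ~~ adj x y.
Proof. by move=> Dc xD yS; apply: contra => xy; apply: (comps_adj Dc xD xy). Qed.

(** For l0 beyond Z adjacent to c, the path x - t - c - l0 is induced, so it
    dominates; a vertex l beyond Z in another component than l0 can only be
    adjacent to c.  With at least three components, going through a third one
    also reaches the component of l0. *)
Lemma complete_far T Z x t c l : tight T -> 2 < #|T| -> Z \in comps adj T ->
  x \in Z -> t \in Z -> adj x t -> c \in T -> adj t c -> ~~ adj x c ->
  l \notin T -> l \notin Z -> adj c l.
Proof.
move=> tT T3 Zc xZ tZ xt cT tc nxc.
have key l0 l1 : l0 \notin T -> l0 \notin Z -> adj c l0 -> l1 \notin T -> l1 \notin Z ->
    ~~ adj l1 l0 -> adj c l1.
  move=> l0T l0Z cl0 l1T l1Z nl.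
  have n y w : y \in Z -> w \notin T -> w \notin Z -> ~~ adj y w by exact: comps_nadj.
  have := domP4 l1 xt tc cl0 nxc (n _ _ xZ l0T l0Z) (n _ _ tZ l0T l0Z).
  rewrite (negbTE nl) ![adj l1 _]adj_sym (negbTE (n _ _ xZ l1T l1Z)).
  by rewrite (negbTE (n _ _ tZ l1T l1Z)) /= orbF.
have [l0 cl0 /andP[l0T l0Z]] := touch_other tT cT Zc.
have [L0 L0c l0L] := comps_cover (@adj_sym G) l0T.
have [L1 [L1c L1Z L10]] : exists L1, [/\ L1 \in comps adj T, L1 != Z & L1 != L0].
  have /set0Pn[L1] : comps adj T :\: [set Z; L0] != set0.
    rewrite -card_gt0 cardsD (tight_card tT).
    have := subset_leq_card (subsetIr (comps adj T) [set Z; L0]).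
    by move: T3; rewrite cards2; case: eqP => _; cardlia.
  by rewrite !inE negb_or -andbA => /and3P[? ? ?]; exists L1.
have [l1 l1L] := comps_n0 L1c; have l1T := comps_notin L1c l1L.
have l1Z : l1 \notin Z by apply: contra L1Z => h; apply/eqP/(comps_eq L1c Zc l1L h).
have cl1 : adj c l1.
  apply: (key l0) => //; apply: contra L10 => h; apply/eqP.
  exact: comps_adj_eq L1c L0c l1L l0L h.
move=> lT lZ; have [h|h] := boolP (adj l l0); last exact: key h.
apply: (key l1) => //; apply: contra L10 => h'; apply/eqP.
have lL0 : l \in L0 by apply: (comps_adj L0c l0L) lT; rewrite adj_sym.
by rewrite (comps_adj_eq L0c L1c lL0 l1L h').
Qed.

(** * Cuts given by critical edges *)

(** The edge uv is a bridge of the component A + B of G - S, and S meets the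
    toughness bound with equality.  |S| = 1 is not excluded here. *)
Record bridge_cut u v S A B : Prop := BridgeCut {
  bc_u : u \in A;
  bc_v : v \in B;
  bc_A : conn adj A;
  bc_B : conn adj B;
  bc_dis : [disjoint A & B];
  bc_cross : forall a b, a \in A -> b \in B -> adj a b -> a = u /\ b = v;
  bc_comp : A :|: B \in comps adj S;
  bc_card : #|comps adj S| = #|S|;
  bc_pos : 0 < #|S| }.

Lemma bridge_cut_sym u v S A B : bridge_cut u v S A B -> bridge_cut v u S B A.
Proof.
case=> uA vB cA cB dAB cross com card pos; split; rewrite 1?disjoint_sym 1?setUC //.
by move=> b a bB aA; rewrite adj_sym => /(cross _ _ aA bB)[].
Qed.

Lemma set2_eqP (u v x y : G) : [set x; y] = [set u; v] ->
  (x = u /\ y = v) \/ (x = v /\ y = u) \/ (x = y).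
Proof.
move=> e; have : x \in [set u; v] by rewrite -e !inE eqxx.
have : y \in [set u; v] by rewrite -e !inE eqxx orbT.
rewrite !inE => /orP[] /eqP -> /orP[] /eqP ->; tauto.
Qed.

Lemma del_edge_adj (u v x y : G) : adj x y -> ~ (x = u /\ y = v) ->
  ~ (x = v /\ y = u) -> del_edge_rel u v x y.
Proof.
move=> xy n1 n2; rewrite /del_edge_rel xy; apply/eqP => /set2_eqP[//|[//|e]].
by rewrite e adj_irr in xy.
Qed.

Lemma adj_del_edge (u v x y : G) : del_edge_rel u v x y -> adj x y.
Proof. by case/andP. Qed.

Lemma del_edge_comps (u v : G) (S P : {set G}) :
  P \in comps (del_edge_rel u v) S ->
  (u \in P -> v \in P :|: S) -> (v \in P -> u \in P :|: S) -> P \in comps adj S.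
Proof.
move=> Pc uv vu; rewrite compsE; apply/minsetP; split=> [|X].
  apply/islandP; split=> [|x|x y xP xy yS].
  - exact: comps_n0 Pc.
  - exact: comps_notin Pc.
  have [/andP[/eqP ex /eqP ey]|n1] := boolP ((x == u) && (y == v)).
    by move: (uv); rewrite -ex -ey inE (negbTE yS) orbF; apply.
  have [/andP[/eqP ex /eqP ey]|n2] := boolP ((x == v) && (y == u)).
    by move: (vu); rewrite -ex -ey inE (negbTE yS) orbF; apply.
  apply: (comps_adj Pc xP _ yS); apply: del_edge_adj => // -[ex ey].
    by rewrite ex ey !eqxx in n1.
  by rewrite ex ey !eqxx in n2.
move=> /islandP[[x xX] XS clX] XP; apply/eqP; rewrite eqEsubset XP /=.
apply: (comps_conn Pc) => [|y z yP yX zP yz]; first by exists x => //; apply: (subsetP XP).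
by apply: (clX _ _ yX (adj_del_edge yz)); apply: comps_notin Pc zP.
Qed.

Lemma conn_del_edge u v A : conn (del_edge_rel u v) A -> conn adj A.
Proof.
move=> cA X nz cl; apply: (cA X nz) => x y xA xX yA /adj_del_edge.
exact: cl.
Qed.

(** A bridge of the whole graph has an end u of degree at least 3, which would
    be a cut vertex. *)
Lemma no_bridge u v A B : u \in A -> v \in B -> (forall x, x \in A -> x \notin B) ->
  (forall a b, a \in A -> b \in B -> adj a b -> a = u /\ b = v) ->
  (forall x, x \in A :|: B) -> False.
Proof.
move=> uA vB disj cross AB.
have [|a ua] := @third_neighbour u [set v]; first by rewrite cards1.
rewrite inE => av.
have aA : a \in A.
  have := AB a; rewrite inE => /orP[//|aB].
  by have [_ e] := cross _ _ uA aB ua; rewrite e eqxx in av.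
have au : a \in A :\ u by rewrite !inE eq_sym adj_neq.
suff : 1 < #|[set u]| by rewrite cards1.
apply: (@two_islands [set u] (A :\ u) B a v) => //.
- apply/islandP; split=> [|x|x y]; first by exists a.
    by rewrite !inE => /andP[].
  rewrite !inE => /andP[xu xA] xy yu; rewrite yu /=.
  have := AB y; rewrite inE => /orP[//|yB].
  by have [e] := cross _ _ xA yB xy; rewrite e eqxx in xu.
- apply/islandP; split=> [|x xB|x y xB xy]; first by exists v.
    by rewrite inE; apply: contraTneq xB => ->; apply: disj.
  rewrite inE => yu; have := AB y; rewrite inE => /orP[yA|//].
  by have [e] := cross _ _ yA xB (adjC xy); rewrite e eqxx in yu.
- by move=> x; rewrite inE => /andP[_ /disj].
Qed.

(** A set S violating toughness after the deletion of uv must separate u from v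
    there, since otherwise its components are also components of G - S.
    Putting the edge back merges exactly two components, so G - S has at least
    |S| of them. *)
Lemma edge_bridge_cut u v : adj u v -> exists S A B, bridge_cut u v S A B.
Proof.
move=> uv; have [S [gt1 gtS]] := critical uv; set r := del_edge_rel u v in gt1 gtS.
have symr : symmetric r by exact: del_edge_sym.
have le : {subset comps r S <= comps adj S} -> False.
  move=> /subsetP/subset_leq_card le; have := tough1 (leq_trans gt1 le).
  by move: gtS le; cardlia.
have uS : u \notin S.
  apply/negP => uS; apply: le => P Pc; apply: (del_edge_comps Pc) => [uP|_].
    by have := comps_notin Pc uP; rewrite uS.
  by rewrite inE uS orbT.
have vS : v \notin S.
  apply/negP => vS; apply: le => P Pc; apply: (del_edge_comps Pc) => [_|vP].
    by rewrite inE vS orbT.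
  by have := comps_notin Pc vP; rewrite vS.
have [A Ac uA] := comps_cover symr uS; have [B Bc vB] := comps_cover symr vS.
have AB : A != B.
  apply/eqP => AB; apply: le => P Pc; apply: (del_edge_comps Pc) => [uP|vP]; rewrite inE.
    by rewrite (comps_eq Pc Ac uP uA) AB vB.
  by rewrite (comps_eq Pc Bc vP vB) -AB uA.
have disj x : x \in A -> x \notin B.
  by move=> xA; apply: contra AB => xB; apply/eqP; apply: (comps_eq Ac Bc xA xB).
have uv' : u != v by exact: adj_neq.
have cross a b : a \in A -> b \in B -> adj a b -> a = u /\ b = v.
  move=> aA bB ab; have [/andP[/eqP -> /eqP ->] //|n1] := boolP ((a == u) && (b == v)).
  case/eqP: AB; apply: (comps_adj_eq Ac Bc aA bB); apply: del_edge_adj => //.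
    by case=> ea eb; rewrite ea eb !eqxx in n1.
  by case=> ea eb; move: (disj _ aA); rewrite ea vB.
have cA := comps_conn Ac; have cB := comps_conn Bc.
have ABc : A :|: B \in comps adj S.
  rewrite compsE; apply/minsetP; split=> [|X].
    apply/islandP; split=> [|x|x y]; first by exists u; rewrite inE uA.
      by rewrite inE => /orP[]; [apply: comps_notin Ac|apply: comps_notin Bc].
    move=> xAB xy yS; have [/andP[_ /eqP ->]|n1] := boolP ((x == u) && (y == v)).
      by rewrite inE vB orbT.
    have [/andP[_ /eqP ->]|n2] := boolP ((x == v) && (y == u)); first by rewrite inE uA.
    have rxy : r x y.
      by apply: del_edge_adj => // -[ex ey]; [move: n1|move: n2]; rewrite ex ey !eqxx.
    move: xAB; rewrite !inE => /orP[xA|xB]; first by rewrite (comps_adj Ac xA rxy yS).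
    by rewrite (comps_adj Bc xB rxy yS) orbT.
  move=> /islandP[[x xX] XS clX] XAB; apply/eqP; rewrite eqEsubset XAB /=.
  have sub C : C \in comps r S -> (exists2 x, x \in C & x \in X) -> C \subset X.
    move=> Cc nz; apply: (comps_conn Cc nz) => y z yC yX zC yz.
    by apply: (clX y z yX (adj_del_edge yz)); apply: comps_notin Cc zC.
  have [sA|sB] : A \subset X \/ B \subset X.
  - have := subsetP XAB _ xX; rewrite inE => /orP[xA|xB]; [left|right]; apply: sub => //; by exists x.
  - have sB : B \subset X.
      by apply: sub => //; exists v => //; apply: (clX u v (subsetP sA _ uA) uv vS).
    by rewrite subUset sA.
  have sA : A \subset X.
    by apply: sub => //; exists u => //; apply: (clX v u (subsetP sB _ vB) (adjC uv) uS).
  by rewrite subUset sA.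
have le1 : #|comps r S| <= #|comps adj S| .+1.
  set R := comps r S :\: [set A; B].
  have nR : A :|: B \notin R.
    apply/negP; rewrite !inE negb_or => /andP[/andP[nA nB] c].
    by case/eqP: nA; apply: (comps_eq c Ac _ uA); rewrite inE uA.
  have : (A :|: B) |: R \subset comps adj S.
    rewrite subUset sub1set ABc; apply/subsetP => P.
    rewrite !inE negb_or => /andP[/andP[nA nB] Pc]; apply: (del_edge_comps Pc) => h.
      by case/eqP: nA; apply: (comps_eq Pc Ac h uA).
    by case/eqP: nB; apply: (comps_eq Pc Bc h vB).
  move/subset_leq_card; rewrite cardsU1 nR add1n cardsD.
  have := subset_leq_card (subsetIr (comps r S) [set A; B]); rewrite cards2 AB.
  cardlia.
have pos : 0 < #|comps adj S| by rewrite card_gt0; apply/set0Pn; exists (A :|: B).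
have [c2|c1] := leqP 2 #|comps adj S|.
  exists S, A, B; split=> //.
  - exact: conn_del_edge cA.
  - exact: conn_del_edge cB.
  - by rewrite disjoint_subset; apply/subsetP => x /disj; rewrite inE.
  - by move: (tough1 c2) gtS le1; cardlia.
  - by move: c2 (tough1 c2); cardlia.
have one P : P \in comps adj S -> P = A :|: B.
  move=> Pc; apply/eqP; apply: contraLR c1 => nP; rewrite -leqNgt.
  by apply/card_gt1P; exists P, (A :|: B).
have S0 : 0 < #|S|.
  rewrite card_gt0; apply/eqP => S0; apply: (no_bridge uA vB disj cross) => x.
  have xS : x \notin S by rewrite S0 inE.
  by have [D /one <-] := comps_cover (@adj_sym G) xS.
exists S, A, B; split=> //.
- exact: conn_del_edge cA.
- exact: conn_del_edge cB.
- by rewrite disjoint_subset; apply/subsetP => x /disj; rewrite inE.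
- by move: pos c1 gtS le1 S0; cardlia.
Qed.

(** Either u dominates A, or an induced path with three vertices starts at u
    inside A. *)
Lemma far_vertex A u : conn adj A -> u \in A ->
  (forall a, a \in A -> a != u -> adj u a) \/
  exists a b, [/\ a \in A, b \in A & adj u a] /\ [/\ adj a b, b != u & ~~ adj u b].
Proof.
move=> cA uA; pose X := u |: [set a | adj u a].
have [/existsP[a /existsP[b /and5P[aA bA ua ab /andP[ub bu]]]]|no] := boolP
  [exists a, exists b, [&& a \in A, b \in A, adj u a, adj a b & ~~ adj u b && (b != u)]].
  by right; exists a, b.
left=> a aA au; suff /subsetP /(_ a aA) : A \subset X by rewrite !inE (negbTE au).
apply: cA => [|x y xA xX yA xy]; first by exists u => //; rewrite !inE eqxx.
apply: contraR no => yX; move: xX yX; rewrite !inE negb_or => /orP[/eqP <-|ux] /andP[yu uy].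
  by rewrite xy in uy.
by apply/existsP; exists x; apply/existsP; exists y; rewrite xA yA ux xy uy.
Qed.

Lemma single_comp S C x : #|comps adj S| = 1 -> C \in comps adj S ->
  x \notin S -> x \in C.
Proof.
move=> c1 Cc xS; have [D Dc xD] := comps_cover (@adj_sym G) xS.
have /cards1P[C' e] : #|comps adj S| == 1 by rewrite c1.
by move: Cc Dc; rewrite e !inE => /eqP -> /eqP <-.
Qed.

(** Let s be the single vertex of the cut, and suppose that v dominates its side
    B.  For a neighbour b of v in B, consider the cut T of the edge vb.  All of
    B outside T stays in the component of v, so T could be replaced by T minus
    B: this frees the vertices of T in B, among them all common neighbours of v
    and b, and costs at most one component (the one of s). *)
Lemma singleton_cut_absurd u v s A B : bridge_cut u v [set s] A B ->
  (forall b, b \in B -> b != v -> adj v b) -> False.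
Proof.
case=> uA vB cA cB dAB cross ABc; rewrite cards1 => c1 _ dom.
have V x : x != s -> x \in A \/ x \in B.
  move=> xs; have : x \in A :|: B by apply: single_comp c1 ABc _; rewrite inE.
  by rewrite inE => /orP.
have sAB x : x \in A :|: B -> x != s by move/(comps_notin ABc); rewrite inE.
have sA x : x \in A -> x != s by move=> xA; apply: sAB; rewrite inE xA.
have sB x : x \in B -> x != s by move=> xB; apply: sAB; rewrite inE xB orbT.
have disj x : x \in A -> x \in B -> False by move=> xA; rewrite (disjointFr dAB xA).
(* Otherwise v would be a cut vertex. *)
have [a0 [a0A sa0]] : exists a, a \in A /\ adj s a.
  have [/exists_inP[a aA sa]|no] := boolP [exists a in A, adj s a]; first by exists a.
  have noS a : a \in A -> adj s a -> False by move=> aA sa; case/exists_inP: no; exists a.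
  suff : 1 < #|[set v]| by rewrite cards1.
  apply: (@two_islands [set v] A (~: (v |: A)) u s) => //.
  - apply/islandP; split=> [|x xA|x y xA xy]; first by exists u.
      by rewrite inE; apply/eqP => e; apply: (disj x) => //; rewrite e.
    rewrite inE => yv; have [ys|/V[//|yB]] := eqVneq y s.
      by case: (noS _ xA); rewrite -ys adjC.
    by have [_ e] := cross _ _ xA yB xy; rewrite e eqxx in yv.
  - apply/islandP; split=> [|x|x y].
    + exists s; rewrite !inE negb_or eq_sym (sB _ vB) /=.
      by apply/negP => /sA; rewrite eqxx.
    + by rewrite !inE negb_or => /andP[].
    + rewrite !inE !negb_or => /andP[xv xA] xy yv; rewrite yv /=.
      apply/negP => yA; have [xs|/V[h|xB]] := eqVneq x s; last 1 first.
      * by have [_ e] := cross _ _ yA xB (adjC xy); rewrite e eqxx in xv.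
      * by apply: (noS _ yA); rewrite -xs.
      * by rewrite h in xA.
  - rewrite !inE negb_or eq_sym (sB _ vB) /=.
    by apply/negP => /sA; rewrite eqxx.
  - by move=> x xA; rewrite !inE xA orbT.
have [|b vb] := @third_neighbour v [set u; s]; first by rewrite cards2; case: eqP.
rewrite !inE negb_or => /andP[bu bs].
have bB : b \in B.
  by case: (V _ bs) => // bA; have [e] := cross _ _ bA vB (adjC vb); rewrite e eqxx in bu.
have bv : b != v by rewrite eq_sym adj_neq.
have [T [A2 [B2 [vA2 bB2 cA2 cB2 d2 cross2 Cc cardT posT]]]] := edge_bridge_cut vb.
set C := A2 :|: B2 in Cc.
have disj2 x : x \in A2 -> x \in B2 -> False by move=> xA; rewrite (disjointFr d2 xA).
have vC : v \in C by rewrite inE vA2.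
have bC : b \in C by rewrite inE bB2 orbT.
have vT := comps_notin Cc vC; have bT := comps_notin Cc bC.
have nbT y : adj b y -> y \in B -> y != v -> y \in T.
  move=> bY yB yv; apply: contraT => yT; have vy := dom _ yB yv.
  have : y \in C by apply: comps_adj Cc bC bY yT.
  rewrite inE => /orP[yA2|yB2].
    by have [e] := cross2 _ _ yA2 bB2 (adjC bY); rewrite e eqxx in yv.
  by have [_ e] := cross2 _ _ vA2 yB2 vy; rewrite e adj_irr in bY.
have BC y : y \in B -> y \notin T -> y \in C.
  move=> yB yT; have [-> //|yv] := eqVneq y v.
  exact: comps_adj Cc vC (dom _ yB yv) yT.
have bnb y : adj b y -> y \in [set v; s] :|: (T :&: B).
  move=> bY; rewrite !inE; have [//|yv] := eqVneq y v.
  have [//|/V[yA|yB]] := eqVneq y s; last by rewrite yB (nbT _ bY yB yv).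
  by have [_ e] := cross _ _ yA bB (adjC bY); rewrite e eqxx in bv.
have degb : 2 < #|[set v; s] :|: (T :&: B)|.
  by apply: leq_trans (deg3 b) _; apply: subset_leq_card; apply/subsetP => y; rewrite inE; apply: bnb.
have TB1 : 0 < #|T :&: B|.
  rewrite card_gt0; apply: contraTneq degb => ->; rewrite setU0 cards2; by case: eqP.
have bsTB : ~~ adj b s -> 1 < #|T :&: B|.
  move=> nbs; have : #|[set w | adj b w]| <= #|v |: (T :&: B)|.
    apply: subset_leq_card; apply/subsetP => y; rewrite inE => bY.
    have := bnb _ bY; rewrite !inE -orbA => /or3P[->//|/eqP e|->]; last by rewrite orbT.
    by rewrite e (negbTE nbs) in bY.
  have := deg3 b; rewrite /degree cardsU1; case: (v \notin _); cardlia.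
(* If T lies inside B, then G - T is connected, so |T| = 1 and b must be
   adjacent to s; the way from b through s and A to v avoids the edge vb. *)
have [TsB|nTB] := boolP (T \subset B).
  have AnT a : a \in A -> a \notin T.
    by move=> aA; apply/negP => /(subsetP TsB); apply: disj.
  have sT : s \notin T by apply/negP => /(subsetP TsB)/sB; rewrite eqxx.
  have uv : adj u v.
    have [//|nuv] := boolP (adj u v); exfalso.
    suff : 1 < #|[set s]| by rewrite cards1.
    apply: (@two_islands [set s] A B u v) => //.
    - apply/islandP; split=> [|x /sA|x y xA xy]; rewrite ?inE //; first by exists u.
      move/V => [//|yB]; have [ex ey] := cross _ _ xA yB xy.
      by rewrite -ex -ey xy in nuv.
    - apply/islandP; split=> [|x /sB|x y xB xy]; rewrite ?inE //; first by exists v.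
      move/V => [yA|//]; have [ey ex] := cross _ _ yA xB (adjC xy).
      by rewrite -ex -ey adj_sym xy in nuv.
    by move=> x xA; apply/negP; apply: disj.
  have uC : u \in C by apply: comps_adj Cc vC (adjC uv) (AnT _ uA).
  have AC : A \subset C.
    by apply: cA => [|x y _ xC yA xy]; [exists u|apply: comps_adj Cc xC xy (AnT _ yA)].
  have sC : s \in C by apply: comps_adj Cc (subsetP AC _ a0A) (adjC sa0) sT.
  have one : #|comps adj T| = 1.
    suff -> : comps adj T = [set C] by rewrite cards1.
    apply/setP => D; rewrite inE; apply/idP/eqP => [Dc|-> //].
    have [x xD] := comps_n0 Dc; have xT := comps_notin Dc xD.
    apply: (comps_eq Dc Cc xD); have [-> //|/V[xA|xB]] := eqVneq x s.
      exact: (subsetP AC).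
    exact: BC.
  have bs' : adj b s.
    apply: contraT => /bsTB; have := subset_leq_card (subsetIl T B).
    by rewrite -cardT one; cardlia.
  have sB2 : s \in B2.
    move: sC; rewrite inE => /orP[sA2|//].
    have [e] := cross2 _ _ sA2 bB2 (adjC bs').
    by move: (sB _ vB); rewrite e eqxx.
  have stay x y : x \in B2 -> y \in A -> adj x y -> y \in B2.
    move=> xB2 yA xy; have := subsetP AC _ yA; rewrite inE => /orP[yA2|//].
    have [e] := cross2 _ _ yA2 xB2 (adjC xy).
    by case: (disj _ yA); rewrite e.
  have uB2 : u \in B2.
    suff /subsetP : A \subset B2 by apply.
    apply: cA => [|x y _ xB2 yA xy]; last exact: stay xy.
    by exists a0 => //; apply: stay sa0.
  have [_ e] := cross2 _ _ vA2 uB2 (adjC uv).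
  by case: (disj _ uA); rewrite e.
(* K collects the components that merge when T is replaced by T minus B. *)
pose K := [set D in comps adj T | (D == C) || (s \in D)].
pose W := B :|: cover K; pose R := comps adj T :\: K.
have CK : C \in K by rewrite inE Cc eqxx.
have inK x D : D \in comps adj T -> D \notin K -> x \in D -> x \notin B /\ x != s.
  move=> Dc nK xD; split; apply: contra nK => h; rewrite inE Dc.
    by rewrite (comps_eq Dc Cc xD (BC _ h (comps_notin Dc xD))) eqxx.
  by rewrite -(eqP h) xD orbT.
have KT D : D \in K -> D \in comps adj T by rewrite inE => /andP[].
have pR : packing (T :\: B) R.
  split=> [P|P Q x /setDP[Pc _] /setDP[Qc _]]; last exact: comps_eq Pc Qc.
  rewrite inE => /andP[nK Pc]; apply/islandP; split=> [|x xP|x y xP xy].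
  - exact: comps_n0 Pc.
  - by rewrite inE (negbTE (comps_notin Pc xP)) andbF.
  rewrite inE negb_and negbK => /orP[yB|]; last exact: comps_adj Pc xP xy.
  have [xB xs] := inK _ _ Pc nK xP.
  have [yT|yT] := boolP (y \in T); last exact: comps_adj Pc xP xy yT.
  case: (V _ xs) => [xA|h]; last by rewrite h in xB.
  by have [_ e] := cross _ _ xA yB xy; rewrite -e yT in vT.
have iW : island adj (T :\: B) W.
  apply/islandP; split=> [|x|x y xW xy].
  - by exists v; rewrite inE vB.
  - rewrite !inE => /orP[-> //|/bigcupP[D /KT Dc xD]].
    by rewrite (negbTE (comps_notin Dc xD)) andbF.
  rewrite !inE negb_and negbK => /orP[-> //|yT]; apply/orP.
  have cov D : y \in D -> D \in K -> y \in B \/ y \in cover K.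
    by move=> yD DK; right; apply/bigcupP; exists D.
  move: xW; rewrite inE => /orP[xB|/bigcupP[D DK xD]]; last first.
    by apply: (cov D) => //; apply: comps_adj (KT _ DK) xD xy yT.
  have [ys|/V[yA|yB]] := eqVneq y s; last by left.
    have [D Dc yD] := comps_cover (@adj_sym G) yT; apply: (cov D) => //.
    by rewrite inE Dc -ys yD orbT.
  have [ey ex] := cross _ _ yA xB (adjC xy).
  by apply: (cov C) => //; apply: comps_adj Cc vC _ yT; rewrite -ex.
have [|pW cW] := packing1 pR iW.
  move=> P x; rewrite inE => /andP[nK Pc] xW; apply/negP => xP.
  have [xB _] := inK _ _ Pc nK xP.
  move: xW; rewrite inE (negbTE xB) => /bigcupP[D DK xD].
  by move: nK; rewrite -(comps_eq (KT _ DK) Pc xD xP) DK.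
have := packing_tough pW; rewrite cW /R (cardsD (comps adj T)) cardT (cardsD T).
have -> : comps adj T :&: K = K by apply/setIidPr/subsetP => D /KT.
have KleT : #|K| <= #|T|.
  by rewrite -cardT; apply/subset_leq_card/subsetP => D /KT.
have T1 : #|T :&: B| < #|T| by apply/proper_card/properP; split; [exact: subsetIl|case/subsetPn: nTB => x xT xB; exists x; rewrite ?inE ?xT].
(* Merging two components requires s to be apart from b; then b has two
   neighbours in T and B, which pays for the loss. *)
have K2 : #|K| <= 1 \/ #|K| <= 2 /\ 1 < #|T :&: B|.
  have [/bsTB TB2|/negPn bs'] := boolP (~~ adj b s).
    right; split=> //; have [D0 sub] : exists D0, K \subset [set C; D0].
      have [/existsP[D0 /andP[D0c sD0]]|no] := boolP [exists D, (D \in comps adj T) && (s \in D)].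
        exists D0; apply/subsetP => D; rewrite !inE => /andP[Dc /orP[->//|sD]].
        by rewrite (comps_eq Dc D0c sD sD0) eqxx orbT.
      exists C; apply/subsetP => D; rewrite !inE => /andP[Dc /orP[->//|sD]].
      by case/existsP: no; exists D; rewrite Dc.
    by apply: leq_trans (subset_leq_card sub) _; rewrite cards2; case: eqP.
  left; rewrite -(cards1 C); apply/subset_leq_card/subsetP => D; rewrite !inE.
  case/andP => Dc /orP[//|sD]; apply/eqP; apply: (comps_eq Dc Cc sD).
  exact: comps_adj Cc bC bs' (comps_notin Dc sD).
by move: KleT K2 T1 TB1; cardlia.
Qed.

(** If neither end dominates its side, then a path with three vertices going
    away from u, extended by v, is an induced P4, and it misses every vertex of
    the other side not adjacent to v. *)
Lemma bridge_cut_gt1 u v S A B : adj u v -> bridge_cut u v S A B -> 1 < #|S|.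
Proof.
move=> uv bc; have pos := bc_pos bc; rewrite ltn_neqAle pos andbT eq_sym.
apply/negP => /cards1P[s eS]; rewrite eS in bc.
have [dom|[a1 [a2 [[a1A a2A ua1] [a12 a2u nua2]]]]] := far_vertex (bc_A bc) (bc_u bc).
  exact: singleton_cut_absurd (bridge_cut_sym bc) dom.
have [dom|[b1 [b2 [[_ b2B _] [_ b2v nvb2]]]]] := far_vertex (bc_B bc) (bc_v bc).
  exact: singleton_cut_absurd bc dom.
have cross := bc_cross bc; have a1u : a1 != u by rewrite eq_sym adj_neq.
have nA a b : a \in A -> b \in B -> a != u -> ~~ adj a b.
  by move=> aA bB au; apply: contra au => /(cross _ _ aA bB)[->].
have := domP4 b2 (adjC a12) (adjC ua1) uv; rewrite (adj_sym a2) (adj_sym b2 u) (adj_sym b2 v).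
rewrite nua2 (negbTE nvb2) !nA ?(bc_v bc) // ![adj b2 _]adj_sym.
rewrite (negbTE (nA _ _ a1A b2B a1u)) (negbTE (nA _ _ a2A b2B a2u)) orbF.
have [ub2|_] := boolP (adj u b2); last by move/(_ isT isT isT).
by have [_ e] := cross _ _ (bc_u bc) b2B ub2; rewrite e eqxx in b2v.
Qed.

(** The edge xt hangs as a pendant edge in the component {x, t} + E of G - T: x
    has no neighbour in E, and t is adjacent to all of E. *)
Record leaf_cut x t T E : Prop := LeafCut {
  lc_adj : adj x t;
  lc_tight : tight T;
  lc_comp : [set x; t] :|: E \in comps adj T;
  lc_x : x \notin E;
  lc_nb : forall y, adj x y -> (y == t) || (y \in T);
  lc_E : forall e, e \in E -> adj t e }.

Lemma bridge_cut_leaf u v S A B : adj u v -> bridge_cut u v S A B -> B = [set v] ->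
  leaf_cut v u S (A :\ u).
Proof.
move=> uv bc eB; have vu := adjC uv; have tS : tight S.
  by rewrite /tight (bridge_cut_gt1 uv bc) (bc_card bc) eqxx.
have [uA vB cA _ dAB cross ABc _ _] := bc.
have Z x : (x \in [set v; u] :|: A :\ u) = (x \in A :|: B).
  rewrite eB !inE; case: (x =P u) => [->|_]; by rewrite ?uA ?orbT //= orbC ?orbF.
split=> //.
- by rewrite (_ : _ :|: _ = A :|: B) //; apply/setP.
- by rewrite inE negb_and (disjointFl dAB vB) orbT.
- move=> y vy; case: (boolP (y \in S)) => yS; rewrite ?orbT // orbF.
  have vAB : v \in A :|: B by rewrite inE vB orbT.
  have := comps_adj ABc vAB vy yS.
  rewrite eB !inE => /orP[yA|/eqP e]; last by rewrite e adj_irr in vy.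
  by have [->] := cross _ _ yA vB (adjC vy).
move=> e /setD1P[eu eA]; have [dom|[a1 [a2 [[a1A a2A ua1] [a12 a2u nua2]]]]] := far_vertex cA uA.
  exact: dom.
have a1u : a1 != u by rewrite eq_sym adj_neq.
have /set0Pn[D] : comps adj S :\ (A :|: B) != set0.
  rewrite -card_gt0; have := cardsD1 (A :|: B) (comps adj S); rewrite ABc (tight_card tS).
  by move: (tight_gt1 tS); cardlia.
case/setD1P => DAB Dc; have [z zD] := comps_n0 Dc.
have nz x : x \in A :|: B -> adj z x = false.
  by move=> xAB; apply: contraNF DAB => zx; apply/eqP; apply: comps_adj_eq Dc ABc zD xAB zx.
have nA a : a \in A -> a != u -> ~~ adj a v.
  by move=> aA au; apply: contra au => /(cross _ _ aA vB)[->].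
have := domP4 z (adjC a12) (adjC ua1) uv; rewrite (adj_sym a2) nua2 !nA //.
by rewrite !nz ?inE ?a1A ?a2A ?uA ?vB ?orbT // => /(_ isT isT isT).
Qed.

(** Neighbours of u and of v on their two sides of the bridge would give an
    induced P4, which misses the other components; so one side is a single
    vertex. *)
Lemma edge_leaf_cut u v : adj u v ->
  exists T E, leaf_cut v u T E \/ leaf_cut u v T E.
Proof.
move=> uv; have [S [A [B bc]]] := edge_bridge_cut uv; have vu := adjC uv.
have S1 := bridge_cut_gt1 uv bc; have [uA vB cA cB dAB cross ABc cS _] := bc.
have [/eqP eB|nB] := boolP (B == [set v]).
  by exists S, (A :\ u); left; apply: bridge_cut_leaf bc eB.
have [/eqP eA|nA] := boolP (A == [set u]).
  by exists S, (B :\ v); right; apply: bridge_cut_leaf vu (bridge_cut_sym bc) eA.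
have nbr C w : conn adj C -> w \in C -> C != [set w] -> exists2 x, x \in C & adj w x.
  move=> cC wC nC; have [/exists_inP[x xC wx]|no] := boolP [exists x in C, adj w x].
    by exists x.
  case/eqP: nC; apply/eqP; rewrite eqEsubset sub1set wC andbT.
  apply: cC => [|x y _ /set1P -> yC wy]; first by exists w; rewrite ?inE.
  by case/exists_inP: no; exists y.
have [a aA ua] := nbr _ _ cA uA nA; have [b bB vb] := nbr _ _ cB vB nB.
have au : a != u by rewrite eq_sym adj_neq.
have bv : b != v by rewrite eq_sym adj_neq.
have /card_gt1P[D1 [D2 [D1c D2c D12]]] : 1 < #|comps adj S| by rewrite cS.
have [D Dc DAB] : exists2 D, D \in comps adj S & D != A :|: B.
  by have [e|h] := eqVneq D1 (A :|: B); [exists D2 => //; rewrite -e eq_sym|exists D1].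
have [z zD] := comps_n0 Dc.
have nz x : x \in A :|: B -> adj z x = false.
  by move=> xAB; apply: contraNF DAB => zx; apply/eqP; apply: comps_adj_eq Dc ABc zD xAB zx.
have nav : ~~ adj a v by apply: contra au => /(cross _ _ aA vB)[->].
have nab : ~~ adj a b by apply: contra au => /(cross _ _ aA bB)[->].
have nub : ~~ adj u b by apply: contra bv => /(cross _ _ uA bB)[_ ->].
have := domP4 z (adjC ua) uv vb nav nab nub.
by rewrite !nz // inE ?aA ?uA ?vB ?bB ?orbT.
Qed.

Lemma leaf_cut_adj x t T E y : leaf_cut x t T E -> adj x y -> y != t -> y \in T.
Proof. by move=> lc /(lc_nb lc)/orP[->|]. Qed.

Lemma isolated_comp S x : x \notin S -> (forall y, adj x y -> y \in S) ->
  [set x] \in comps adj S.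
Proof.
move=> xS nb; rewrite compsE; apply/minsetP; split=> [|X].
  apply/islandP; split=> [|y /set1P ->|y z /set1P -> xz] //; first by exists x; rewrite inE.
  by rewrite nb.
move=> /islandP[[y yX] _ _] sX; apply/eqP; rewrite eqEsubset sX sub1set.
by have /set1P <- := subsetP sX _ yX.
Qed.

Lemma lc_zoneE x t E y : (y \in [set x; t] :|: E) = [|| y == x, y == t | y \in E].
Proof. by rewrite !inE orbA. Qed.

Lemma lc_zoneT x t T E y : leaf_cut x t T E ->
  [|| y == x, y == t | y \in E] -> y \notin T.
Proof. by move=> /lc_comp Zc h; apply: (comps_notin Zc); rewrite lc_zoneE. Qed.

Lemma lc_nxE x t T E y : leaf_cut x t T E -> y \in E -> ~~ adj x y.
Proof.
move=> lc yE; apply/negP => /(lc_nb lc)/orP[/eqP e|].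
  by have := lc_E lc yE; rewrite e adj_irr.
by apply/negP; apply: (lc_zoneT lc); rewrite yE !orbT.
Qed.

Lemma lc_tE x t T E : leaf_cut x t T E -> t \notin E.
Proof. by move=> lc; apply/negP => /(lc_E lc); rewrite adj_irr. Qed.

Lemma lc_zone_adj x t T E y z : leaf_cut x t T E ->
  [|| y == x, y == t | y \in E] -> adj y z -> z \notin T ->
  [|| z == x, z == t | z \in E].
Proof.
by move=> /lc_comp Zc; rewrite -!lc_zoneE => yZ yz zT; apply: comps_adj Zc yZ yz zT.
Qed.

Lemma leaf_cut_others x t T E S : leaf_cut x t T E -> T \subset S ->
  S \subset T :|: ([set x; t] :|: E) ->
  packing S (comps adj T :\ ([set x; t] :|: E)).
Proof.
move=> lc TS /subsetP SZ; apply: comps_packing (subsetDl _ _) TS _ => D y DF yD.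
have [_ Dc] := setD1P DF; apply: contra (comps_notin Dc yD) => /SZ.
by rewrite inE (negbTE (other_comp (lc_comp lc) DF yD)) orbF.
Qed.

(** Adding t to T splits the component into {x} and E, which gains one component;
    by toughness there is no further gain. *)
Lemma leaf_cut_isolates x t T E : leaf_cut x t T E -> E != set0 ->
  tight (t |: T) /\ [set x] \in comps adj (t |: T).
Proof.
move=> lc /set0Pn[e eE]; have zT y := lc_zoneT (y := y) lc.
have tT : t \notin T by rewrite zT ?eqxx ?orbT.
set Z := [set x; t] :|: E; have Zc : Z \in comps adj T := lc_comp lc.
have ZE y : (y \in Z) = _ := lc_zoneE x t E y.
have p0 : packing (t |: T) (comps adj T :\ Z).
  apply: (leaf_cut_others lc); rewrite ?subsetUr // subUset subsetUl sub1set.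
  by rewrite inE ZE eqxx !orbT.
have iE : island adj (t |: T) E.
  apply/islandP; split=> [|y yE|y z yE yz]; first by exists e.
    rewrite !inE negb_or zT ?yE ?orbT // andbT.
    by apply: contraNneq (lc_tE lc) => <-.
  rewrite !inE negb_or => /andP[zt zT'].
  have yZ : [|| y == x, y == t | y \in E] by rewrite yE !orbT.
  have /or3P[/eqP zx|h|//] := lc_zone_adj lc yZ yz zT'; last by rewrite h in zt.
  by have := lc_nxE lc yE; rewrite -zx adj_sym yz.
have [|p1 c1] := packing1 p0 iE.
  move=> Q y QF yE; apply: (contraL (other_comp (y := y) Zc QF)).
  by rewrite ZE yE !orbT.
have ix : [set x] \in comps adj (t |: T).
  apply: isolated_comp => [|y /(lc_nb lc)]; last by rewrite !inE.
  by rewrite !inE negb_or (adj_neq (lc_adj lc)) zT ?eqxx.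
have [|p2 c2] := packing1 p1 (comps_island ix).
  move=> Q y /setU1P[->|QF] /set1P ->; first exact: lc_x lc.
  by apply: (contraL (other_comp (y := x) Zc QF)); rewrite ZE eqxx.
have T1 := tight_gt1 (lc_tight lc); have cT := tight_card (lc_tight lc).
have le1 : #|T|.+1 <= #|comps adj (t |: T)|.
  rewrite -cT (cardsD1 Z) Zc add1n -c1 -c2; case: p2 => p21 p22.
  exact: card_islands p21 p22.
have ct : #|t |: T| = #|T|.+1 by rewrite cardsU1 tT.
split=> //; rewrite /tight ct; apply/andP; split; first by move: T1; cardlia.
rewrite eqn_leq le1 andbT -ct; apply: tough1; apply: leq_trans le1.
by move: T1; cardlia.
Qed.

(** * Vertices isolated by a tight set *)

(** Suppose that t is the leaf of the edge tx and B is nonempty.  All of t + B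
    lies in M, and touches at least two components of G - M besides {x}; the
    vertices c1 and c2 doing so belong to T.  By [complete_far] both are
    adjacent to everything beyond the component {t, x} + B, which therefore
    lies in M.  So M contains many vertices and the complement of M few, too
    few for |M| components. *)
Lemma isolated_dominator M x t T B : tight M -> [set x] \in comps adj M ->
  leaf_cut t x T B -> B = set0.
Proof.
move=> tM xc [tx tT Zc tB nbt xB0]; apply/eqP; apply: contraT => /set0Pn[r rB].
have xM : x \notin M by apply: (comps_notin xc); rewrite inE.
have NM y : adj x y -> y \in M.
  move=> xy; apply: contraT => yM.
  have /set1P e : y \in [set x] by apply: comps_adj xc _ xy yM; rewrite inE.
  by rewrite e adj_irr in xy.
set Z := _ :|: B in Zc; have xt := adjC tx.
pose B1 := t |: B.
have xB y : y \in B1 -> adj x y by case/setU1P => [->//|/xB0].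
have B1M y : y \in B1 -> y \in M by move/xB/NM.
have ZE y : (y \in Z) = (y == x) || (y \in B1) by rewrite !inE orbCA orbA.
have xZ : x \in Z by rewrite ZE eqxx.
have xT := comps_notin Zc xZ.
have outT t' c : t' \in B1 -> adj t' c -> c \notin M -> c != x ->
    [/\ c \in T, ~~ adj x c & t' \in Z].
  move=> t'B t'c cM cx; have t'Z : t' \in Z by rewrite ZE t'B orbT.
  split=> //; last by apply: contra cM => /NM.
  apply: comps_adjS Zc t'Z t'c _; rewrite ZE negb_or cx.
  by apply: contra cM => /B1M.
have M3 : 2 < #|M|.
  by apply: leq_trans (deg3 x) _; apply/subset_leq_card/subsetP => y; rewrite inE => /NM.
have tr : t != r by apply: contraNneq tB => ->.
have tB1 : t \in B1 by rewrite !inE eqxx.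
have rB1 : r \in B1 by rewrite !inE rB orbT.
have [D1 [D2 [c1 [c2 [[D1c D2c D12] [c1D c2D]]]]]] : exists D1 D2 c1 c2,
   [/\ D1 \in comps adj M, D2 \in comps adj M & D1 != D2] /\ [/\ c1 \in D1, c2 \in D2
   & (c1 \in T /\ exists2 t1, t1 \in B1 & adj t1 c1 && (c1 != x)) /\
     (c2 \in T /\ exists2 t1, t1 \in B1 & adj t1 c2 && (c2 != x))].
  have trM : [set t; r] \proper M.
    rewrite properEcard cards2 tr M3 andbT; apply/subsetP => y /set2P[] ->; exact: B1M.
  have := tight_touched tM _ trM; rewrite cards2 tr => h.
  have {h}/h : [set t; r] != set0 by apply/set0Pn; exists t; rewrite !inE eqxx.
  rewrite (cardsD1 [set x]) => h.
  have /card_gt1P[D1 [D2 [D1t D2t D12]]] : 1 < #|touched M [set t; r] :\ [set x]|.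
    by move: h; case: (_ \in _); cardlia.
  have get D : D \in touched M [set t; r] :\ [set x] -> D \in comps adj M /\
     exists2 c, c \in D & c \in T /\ exists2 t1, t1 \in B1 & adj t1 c && (c != x).
    case/setD1P => Dx /touchedP[Dc [c [t1 [cD t1B t1c]]]]; split=> //; exists c => //.
    have cx : c != x.
      by apply: contra Dx => /eqP e; apply/eqP; apply: comps_eq Dc xc cD _; rewrite e inE.
    have t1B' : t1 \in B1 by case/set2P: t1B => ->.
    have [cT _ _] := outT _ _ t1B' t1c (comps_notin Dc cD) cx.
    by split=> //; exists t1; rewrite ?t1c.
  have [D1c [c1 c1D h1]] := get _ D1t; have [D2c [c2 c2D h2]] := get _ D2t.
  by exists D1, D2, c1, c2; split=> //; split=> //; split.
case=> -[c1T [t1 t1B /andP[tc1 c1x]]] [c2T [t2 t2B /andP[tc2 c2x]]].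
have c1M := comps_notin D1c c1D; have c2M := comps_notin D2c c2D.
have [_ nxc1 t1Z] := outT _ _ t1B tc1 c1M c1x.
have [_ nxc2 t2Z] := outT _ _ t2B tc2 c2M c2x.
have Nx : #|[set w | adj x w]| <= #|B1| + #|M :&: T|.
  apply: leq_trans (leq_card_setU _ _); apply/subset_leq_card/subsetP => y.
  rewrite in_set => xy; rewrite (in_setU y B1) in_setI (NM _ xy) /=.
  have [//|yB1] := boolP (y \in B1); rewrite orFb.
  have yZ : y \notin Z by rewrite ZE negb_or yB1 andbT eq_sym adj_neq.
  exact: comps_adjS Zc xZ xy yZ.
have degx := deg3 x; rewrite /degree in degx.
have [T3|T2] := ltnP 2 #|T|.
  have LM l : l \notin T -> l \notin Z -> l \in M.
    move=> lT lZ; apply: contraT => lM; case/eqP: D12.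
    have cl1 := complete_far tT T3 Zc xZ t1Z (xB _ t1B) c1T tc1 nxc1 lT lZ.
    have cl2 := complete_far tT T3 Zc xZ t2Z (xB _ t2B) c2T tc2 nxc2 lT lZ.
    by apply: comps_eq D1c D2c (comps_adj D1c c1D cl1 lM) (comps_adj D2c c2D cl2 lM).
  have cM : #|comps adj M| <= #|x |: (T :\: M)|.
    apply: (card_hit (F := comps adj M)) => // D Dc; have [y yD] := comps_n0 Dc.
    exists y => //; have yM := comps_notin Dc yD; rewrite !inE yM /=.
    apply: contraR yM; rewrite negb_or => /andP[yx yT].
    have [yZ|yZ] := boolP (y \in Z); last exact: LM.
    by apply: B1M; move: yZ; rewrite ZE (negbTE yx).
  have xTM : x \notin T :\: M by rewrite inE (negbTE xT) andbF.
  have LT : #|comps adj T :\ Z| <= #|M :\: (B1 :|: T)|.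
    apply: card_hit; first exact: subsetDl.
    move=> D /setD1P[DZ Dc]; have [y yD] := comps_n0 Dc; exists y => //.
    have yT := comps_notin Dc yD.
    have yZ : y \notin Z by apply: contra DZ => yZ; apply/eqP; apply: comps_eq Dc Zc yD yZ.
    rewrite in_setD (in_setU y B1) negb_or yT andbT LM // andbT.
    by move: yZ; rewrite ZE negb_or => /andP[].
  have cMsplit : #|M| = #|B1| + #|M :&: T| + #|M :\: (B1 :|: T)|.
    rewrite -(cardsID (B1 :|: T) M) setIUr; congr (_ + _).
    have -> : M :&: B1 = B1 by apply/setIidPr/subsetP.
    rewrite cardsU (_ : B1 :&: (M :&: T) = set0) ?cards0 ?subn0 //.
    apply/setP => y; rewrite in_set0; apply/negP; rewrite inE => /andP[yB]; rewrite inE.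
    by case/andP => _; apply/negP; apply: (comps_notin Zc); rewrite ZE yB orbT.
  have cZ : #|comps adj T| = (#|comps adj T :\ Z|).+1 by rewrite (cardsD1 Z) Zc.
  move: cM; rewrite cardsU1 xTM add1n cardsD (setIC T) (tight_card tM).
  move: Nx degx cZ LT cMsplit (subset_leq_card (subsetIr M T)); rewrite (tight_card tT).
  by cardlia.
(* The remaining case T = {c1, c2}, where [complete_far] does not apply. *)
have eT : T = [set c1; c2].
  apply/esym/eqP; rewrite eqEcard cards2 subUset !sub1set c1T c2T /=.
  have -> // : c1 != c2.
  by apply: contra D12 => /eqP e; apply/eqP; apply: comps_eq D1c D2c c1D _; rewrite e.
have MT : #|M :&: T| = 0.
  apply/eqP; rewrite cards_eq0; apply/eqP/setP => y; rewrite eT !inE.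
  by apply/negP => /andP[yM /orP[]/eqP e]; [move: c1M|move: c2M]; rewrite -e yM.
rewrite MT addn0 in Nx.
have B3 := leq_trans degx Nx.
have B1n : B1 != set0 by apply/set0Pn; exists t.
have [BM|BM] := boolP (B1 \proper M).
  have := tight_touched tM B1n BM; rewrite ltnNge; case/negP.
  have : #|touched M B1| <= #|x |: T|.
    apply: (card_hit (adj := @adj G) (S := M)) => [|D /touchedP[Dc [c [t' [cD t'B t'c]]]]].
      by apply/subsetP => D /touchedP[].
    exists c => //; rewrite in_setU in_set1; have [//|cx] := eqVneq c x.
    by have [->] := outT _ _ t'B t'c (comps_notin Dc cD) cx.
  rewrite cardsU1 xT; move: T2 B3; cardlia.
have eB : B1 = M.
  apply/eqP; rewrite eqEsubset; move: BM; rewrite properE negb_and negbK.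
  have -> : B1 \subset M by apply/subsetP.
  by [].
have [l1 cl1 /andP[l1T l1Z]] := touch_other tT c1T Zc.
have [l2 cl2 /andP[l2T l2Z]] := touch_other tT c2T Zc.
have [L Lc l1L] := comps_cover (@adj_sym G) l1T.
have [L' L'c l2L'] := comps_cover (@adj_sym G) l2T.
have LL : L' = L.
  apply/eqP; apply: contraTT T2 => LL; rewrite -ltnNge -(tight_card tT).
  apply/card_gt2P; exists L', L, Z; split=> //; split=> //.
    by apply: contra l1Z => /eqP <-.
  by apply: contra l2Z => /eqP ->.
have LM l : l \in L -> l \notin M.
  move=> lL; rewrite -eB; apply: contra l1Z => lB.
  by rewrite -(comps_eq Lc Zc lL) // ZE lB orbT.
have LD : L \subset D1.
  apply: (comps_sub Lc) => [|y z yD1 yz zL]; last by apply: comps_adj D1c yD1 yz (LM _ zL).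
  by exists l1 => //; apply: comps_adj D1c c1D cl1 (LM _ l1L).
case/eqP: D12; rewrite LL in l2L'.
by apply: comps_adj_eq D1c D2c (subsetP LD _ l2L') c2D _; rewrite adj_sym.
Qed.

Lemma leaf_cut_swap x t T : leaf_cut x t T set0 -> leaf_cut t x T set0.
Proof.
move=> [xt tT Zc _ nb _]; split; rewrite ?(in_set0 t) //.
- exact: adjC.
- by rewrite (setUC [set t]).
- move=> y ty; case: (boolP (y \in T)) => yT; rewrite ?orbT // orbF.
  have : y \in [set x; t] :|: set0 by apply: comps_adj Zc _ ty yT; rewrite !inE eqxx orbT.
  by rewrite setU0 !inE => /orP[//|/eqP e]; rewrite e adj_irr in ty.
- by move=> e; rewrite inE.
Qed.

Lemma isolated_leaf M x t : tight M -> [set x] \in comps adj M -> adj x t ->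
  exists T E, leaf_cut x t T E.
Proof.
move=> tM xM xt; have [T [E [lc|lc]]] := edge_leaf_cut xt; last by exists T, E.
by exists T, set0; apply: leaf_cut_swap; rewrite -(isolated_dominator tM xM lc).
Qed.

(** Otherwise each edge xt forms a component of G - T on its own for a tight T.
    Let S, for the edge xs, have maximal size, and let t be another neighbour
    of x.  A neighbour c of t beyond xs lies in T and is adjacent to everything
    outside T and {x, t}, so that T meets all |S| components of G - S; it also
    meets S. *)
Lemma tight_isolated_exists (x : G) : exists M y, tight M /\ [set y] \in comps adj M.
Proof.
have [/existsP[M /existsP[y /andP[tM yM]]]|no] :=
    boolP [exists M, exists y, tight M && ([set y] \in comps adj M)].
  by exists M, y.
exfalso; have noiso M y : tight M -> [set y] \in comps adj M -> False.
  by move=> tM yM; case/existsP: no; exists M; apply/existsP; exists y; rewrite tM.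
have edge t : adj x t -> exists2 T, tight T & [set x; t] \in comps adj T.
  move=> xt; have [T [E lc]] := edge_leaf_cut xt; exists T.
    by case: lc => /lc_tight.
  case: lc => lc; have [E0|E0] := eqVneq E set0.
  - by have := lc_comp lc; rewrite E0 setU0 setUC.
  - by have [/noiso h /h] := leaf_cut_isolates lc E0.
  - by have := lc_comp lc; rewrite E0 setU0.
  - by have [/noiso h /h] := leaf_cut_isolates lc E0.
have pair t T : [set x; t] \in comps adj T -> [/\ x \notin T, t \notin T,
    (forall y, adj x y -> y != t -> y \in T) & forall y, adj t y -> y != x -> y \in T].
  move=> c; have xZ : x \in [set x; t] by rewrite !inE eqxx.
  have tZ : t \in [set x; t] by rewrite !inE eqxx orbT.
  split; rewrite ?(comps_notin c) // => y xy yt.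
    by apply: (comps_adjS c xZ xy); rewrite !inE negb_or yt andbT eq_sym adj_neq.
  by apply: (comps_adjS c tZ xy); rewrite !inE negb_or yt eq_sym adj_neq.
pose good T := tight T && [exists t, adj x t && ([set x; t] \in comps adj T)].
have goodI t T : adj x t -> tight T -> [set x; t] \in comps adj T -> good T.
  by move=> xt tT c; rewrite /good tT; apply/existsP; exists t; rewrite xt.
have [|s0 xs0 _] := @third_neighbour x set0; first by rewrite cards0.
have [T0 tT0 cT0] := edge _ xs0.
have [S /andP[tS /existsP[s /andP[xs cS]]] maxS] :=
  arg_maxnP (fun T => #|T|) (goodI _ _ xs0 tT0 cT0).
have [xS sS nbS _] := pair _ _ cS.
have [|t xt] := @third_neighbour x [set s]; first by rewrite cards1.
rewrite inE => ts; have tS' := nbS _ xt ts.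
have [c tc /andP[cS' cZ]] := touch_other tS tS' cS.
move: cZ; rewrite !inE negb_or => /andP[cx cs].
have [T tT cT] := edge _ xt; have [xT tT' nbT nbTt] := pair _ _ cT.
have cinT := nbTt _ tc cx.
have nxc : ~~ adj x c by apply: contra cS' => xc; apply: nbS.
have T3 : 2 < #|T|.
  have : #|[set w | adj x w]| <= #|t |: (T :\ c)|.
    apply/subset_leq_card/subsetP => y; rewrite !inE => xy.
    have [//|yt] := eqVneq y t; rewrite nbT // andbT.
    by apply: contra nxc => /eqP <-.
  have := deg3 x; rewrite /degree cardsU1 (cardsD1 c T) cinT; case: (_ \notin _); cardlia.
have xZ : x \in [set x; t] by rewrite !inE eqxx.
have tZ : t \in [set x; t] by rewrite !inE eqxx orbT.
have full l := @complete_far T _ x t c l tT T3 cT xZ tZ xt cinT tc nxc.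
have sT : s \in T by apply: nbT xs _; rewrite eq_sym.
have : #|comps adj S| <= #|T :\: S|.
  apply: (card_hit (adj := @adj G) (S := S)) => // D Dc.
  have [->|DZ] := eqVneq D [set x; s].
    by exists s; rewrite !inE ?eqxx ?orbT // sS.
  have [y yD] := comps_n0 Dc; have yS := comps_notin Dc yD.
  have [cD|cD] := boolP (c \in D); first by exists c; rewrite ?inE ?cS'.
  exists y; rewrite // inE yS /=; apply: contraR cD => yT.
  apply: (comps_adj Dc yD _ cS'); rewrite adj_sym; apply: full => //.
  rewrite !inE negb_or; apply/andP; split.
    apply: contra DZ => /eqP e; apply/eqP; apply: comps_eq Dc cS yD _.
    by rewrite e !inE eqxx.
  by apply: contraNneq yS => ->.
have [|w xw] := @third_neighbour x [set s; t]; first by rewrite cards2; case: eqP.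
rewrite !inE negb_or => /andP[ws wt].
have : 0 < #|T :&: S|.
  by rewrite card_gt0; apply/set0Pn; exists w; rewrite inE nbS // nbT.
have := maxS _ (goodI _ _ xt tT cT); rewrite (tight_card tS) -(cardsID S T).
by cardlia.
Qed.

(** Besides the components of F, the removal of T, t and the part of E in M
    leaves {x} and the components of G - T other than {x, t} + E. *)
Lemma leaf_cut_inside x t T E M F : leaf_cut x t T E -> F \subset comps adj M ->
  (forall D, D \in F -> D \subset E) -> #|F| <= #|E :&: M|.+1.
Proof.
move=> lc /subsetP FM FE; have zT y := lc_zoneT (y := y) lc.
set Z := [set x; t] :|: E; have Zc : Z \in comps adj T := lc_comp lc.
have ZE y : (y \in Z) = _ := lc_zoneE x t E y.
pose S := (t |: T) :|: (E :&: M).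
have SE y : (y \in S) = [|| y == t, y \in T | (y \in E) && (y \in M)].
  by rewrite !inE orbA.
have p1 : packing S (comps adj T :\ Z).
  apply: (leaf_cut_others lc); apply/subsetP => y; rewrite SE; first by move=> ->; rewrite orbT.
  by rewrite inE ZE => /or3P[->|->|/andP[-> _]]; rewrite ?orbT.
have p2 : packing S F.
  split=> [D DF|P Q y PF QF]; last exact: comps_eq (FM _ PF) (FM _ QF).
  have Dc := FM _ DF; have DE y : y \in D -> y \in E by move/(subsetP (FE _ DF)).
  apply/islandP; split=> [|y yD|y z yD yz]; first exact: comps_n0 Dc.
    rewrite SE !negb_or negb_and (comps_notin Dc yD) orbT andbT.
    rewrite zT ?DE ?orbT // andbT.
    by apply: contraNneq (lc_tE lc) => <-; apply: DE.
  rewrite SE !negb_or => /and3P[zt zT' zEM].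
  have yZ : [|| y == x, y == t | y \in E] by rewrite DE ?orbT.
  have /or3P[/eqP zx|h|zE] := lc_zone_adj lc yZ yz zT'; last 1 first.
  - by apply: comps_adj Dc yD yz _; rewrite zE in zEM.
  - by have := lc_nxE lc (DE _ yD); rewrite -zx adj_sym yz.
  - by rewrite h in zt.
have [|p3 c3] := packingU p1 p2.
  move=> P Q y PF QF yP; apply: contra (other_comp Zc PF yP) => yQ.
  by rewrite ZE (subsetP (FE _ QF)) ?orbT.
have ix : [set x] \in comps adj S.
  apply: isolated_comp => [|y /(lc_nb lc)]; rewrite SE; last by rewrite orbA => ->.
  by rewrite !negb_or (adj_neq (lc_adj lc)) zT ?eqxx // (negbTE (lc_x lc)).
have [|p4 c4] := packing1 p3 (comps_island ix).
  move=> Q y /setUP[QF|QF] /set1P ->.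
    by apply: (contraL (other_comp (y := x) Zc QF)); rewrite ZE eqxx.
  by apply: contra (lc_x lc); apply: (subsetP (FE _ QF)).
have := packing_tough p4; rewrite c4 c3.
have := cardsD1 Z (comps adj T); rewrite Zc (tight_card (lc_tight lc)).
have /leq_of_leqif := leq_card_setU (t |: T) (E :&: M).
rewrite -/S cardsU1 zT ?eqxx ?orbT //.
by move: (tight_gt1 (lc_tight lc)); cardlia.
Qed.

(** * A maximal isolating set *)

Definition max_isolating x M := [/\ tight M, [set x] \in comps adj M &
  forall M', tight M' -> [set x] \in comps adj M' -> #|M'| <= #|M|].

Lemma isolated_adj M x y : [set x] \in comps adj M -> adj x y -> y \in M.
Proof.
move=> c xy; apply: (comps_adjS c _ xy); rewrite inE //.
by rewrite eq_sym adj_neq.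
Qed.

(** Everything beyond the component {x, t} + E of G - T lies in M or in the
    component D0 of w.  The components of G - M other than {x} and D0 thus
    either lie inside E (J0, few by [leaf_cut_inside]) or meet T (J1).  The
    components of G - T beyond {x, t} + E either meet M (R1) or lie in D0 (R0);
    there are at most |T :&: D0| of the latter, for otherwise M together with
    T :&: D0 would be a larger isolating set.  Adding up, 2 |T :&: M| <= 3,
    although T contains all neighbours of x but t. *)
Lemma no_complete_outside M x t T E w : max_isolating x M -> leaf_cut x t T E ->
  w \in T -> w \notin M ->
  (forall l, l \notin T -> ~~ [|| l == x, l == t | l \in E] -> adj w l) -> False.
Proof.
move=> [tM xc maxM] lc wT wM full.
have xM : x \notin M by apply: (comps_notin xc); rewrite inE.
have NM y : adj x y -> y \in M by apply: isolated_adj.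
have tM' : t \in M := NM _ (lc_adj lc).
have zT y := lc_zoneT (y := y) lc.
have xT : x \notin T by rewrite zT ?eqxx.
have tT : t \notin T by rewrite zT ?eqxx ?orbT.
have ET y : y \in E -> y \notin T by move=> yE; rewrite zT ?yE ?orbT.
have [D0 D0c wD0] := comps_cover (@adj_sym G) wM.
have D0x : D0 != [set x].
  by apply: contraNneq xT => e; move: wD0; rewrite e => /set1P <-.
pose J := comps adj M :\: [set [set x]; D0].
have JP D : D \in J -> [/\ D \in comps adj M, D != [set x] & D != D0].
  by rewrite !inE negb_or -andbA => /and3P[].
pose J1 := [set D in J | ~~ [disjoint D & T]]; pose J0 := J :\: J1.
have cJ : #|J| = #|J0| + #|J1|.
  rewrite -(cardsID J1 J) addnC (setIidPr _) //.
  by apply/subsetP => D; rewrite inE => /andP[].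
have cM : #|M| = #|J| + 2.
  have : [set [set x]; D0] \subset comps adj M by rewrite subUset !sub1set xc D0c.
  move/setIidPr => e; rewrite -(tight_card tM) -(cardsID [set [set x]; D0] (comps adj M)).
  by rewrite e cards2 eq_sym D0x addnC.
have wD y D : D \in comps adj M -> y \in D -> D != D0 -> y \notin T ->
    [|| y == x, y == t | y \in E].
  move=> Dc yD DD0 yT; apply: contraR DD0 => /(full _ yT) wy; apply/eqP/esym.
  exact: comps_adj_eq D0c Dc wD0 yD wy.
have lJ0 : #|J0| <= #|E :&: M|.+1.
  apply: (leaf_cut_inside lc) => [|D].
    by apply/subsetP => D /setDP[/JP[]].
  move=> /setDP[DJ]; rewrite inE DJ /= negbK => dDT; have [Dc Dx DD0] := JP _ DJ.
  apply/subsetP => y yD; have yT : y \notin T by rewrite (disjointFr dDT yD).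
  have /or3P[/eqP e|/eqP e|//] := wD _ _ Dc yD DD0 yT.
    by case/eqP: Dx; apply: comps_eq Dc xc yD _; rewrite e inE.
  by have := comps_notin Dc yD; rewrite e tM'.
have lJ1 : #|J1| <= #|T :\: (M :|: D0)|.
  apply: (card_hit (adj := @adj G) (S := M)) => [|D].
    by apply/subsetP => D; rewrite inE => /andP[/JP[]].
  rewrite inE => /andP[/JP[Dc _ DD0]]; rewrite disjoint_sym => /pred0Pn[y /= /andP[yT yD]].
  exists y => //; rewrite in_setD in_setU negb_or (comps_notin Dc yD) yT andbT /=.
  by apply: contra DD0 => yD0; apply/eqP; apply: comps_eq Dc D0c yD yD0.
have cT : #|T| = #|T :&: M| + #|T :&: D0| + #|T :\: (M :|: D0)|.
  rewrite -(cardsID (M :|: D0) T) setIUr; congr (_ + _).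
  apply: cardsU_disjoint => y; rewrite !in_setI => /andP[-> yM] /=.
  by apply/negP => /(comps_notin D0c); rewrite yM.
pose Z := [set x; t] :|: E; pose R := comps adj T :\ Z.
pose R1 := [set D in R | ~~ [disjoint D & M]]; pose R0 := R :\: R1.
have cR : #|T| = (#|R0| + #|R1|).+1.
  rewrite -(tight_card (lc_tight lc)) (cardsD1 Z) (lc_comp lc) add1n -/R.
  rewrite -(cardsID R1 R) addnC (setIidPr _) //.
  by apply/subsetP => D; rewrite inE => /andP[].
have RP D y : D \in R -> y \in D -> [/\ D \in comps adj T, y \notin T &
    ~~ [|| y == x, y == t | y \in E]].
  case/setD1P => DZ Dc yD; rewrite (comps_notin Dc) // -lc_zoneE; split=> //.
  by apply: contra DZ => yZ; apply/eqP; apply: comps_eq Dc (lc_comp lc) yD yZ.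
have lR1 : #|R1| <= #|M :\: (t |: (T :|: E))|.
  apply: (card_hit (adj := @adj G) (S := T)) => [|D].
    by apply/subsetP => D; rewrite 2!inE => /andP[/andP[]].
  rewrite inE disjoint_sym => /andP[DR /pred0Pn[y /= /andP[yM yD]]].
  exists y => //; have [_ yT] := RP _ _ DR yD; rewrite !negb_or => /and3P[_ yt yE].
  by rewrite !inE !negb_or yt yT yE yM.
have cM2 : #|M| = (#|T :&: M| + #|E :&: M| + #|M :\: (t |: (T :|: E))|).+1.
  rewrite -(cardsID (t |: (T :|: E)) M) -addSn; congr (_ + _).
  have -> : M :&: (t |: (T :|: E)) = t |: ((T :&: M) :|: (E :&: M)).
    by rewrite setIUr [M :&: [set t]](setIidPr _) ?sub1set // setIC setIUl.
  rewrite cardsU1 cardsU_disjoint ?inE ?in_setI ?(negbTE tT) ?(negbTE (lc_tE lc)) //.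
  move=> y; rewrite !in_setI => /andP[yT _]; rewrite negb_and.
  by rewrite (contraL (@ET y)) // yT.
have lR0 : #|R0| <= #|T :&: D0|.
  pose S := M :|: (T :&: D0).
  have sMS : M \subset S by exact: subsetUl.
  have SE y : (y \notin S) = (y \notin M) && ((y \notin T) || (y \notin D0)).
    by rewrite !inE negb_or negb_and.
  have R0P D : D \in R0 -> D \in R /\ forall y, y \in D -> y \notin M.
    case/setDP => DR; rewrite inE DR negbK => dis; split=> // y yD.
    by rewrite (disjointFr dis yD).
  have R0D0 D y : D \in R0 -> y \in D -> y \in D0.
    move=> /R0P[DR DM] yD; have [_ yT yZ] := RP _ _ DR yD.
    exact: comps_adj D0c wD0 (full _ yT yZ) (DM _ yD).
  have p1 : packing S (comps adj M :\ D0).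
    apply: comps_packing (subsetDl _ _) sMS _ => D y /setD1P[DD0 Dc] yD.
    rewrite SE (comps_notin Dc yD) orbC; apply/orP; left.
    by apply: contra DD0 => yD0; apply/eqP; apply: comps_eq Dc D0c yD yD0.
  have p2 : packing S R0.
    split=> [D DR0|D D' y DR D'R yD]; last first.
      have [[/RP h _] [/RP h' _]] := (R0P _ DR, R0P _ D'R).
      by move=> yD'; have [[Dc _ _] [D'c _ _]] := (h _ yD, h' _ yD'); apply: comps_eq Dc D'c yD yD'.
    have [DR DM] := R0P _ DR0; have [_ Dc] := setD1P DR.
    apply/islandP; split=> [|y yD|y z yD yz]; first exact: comps_n0 Dc.
      by rewrite SE (comps_notin Dc yD) DM.
    rewrite SE => /andP[zM zTD]; apply: (comps_adj Dc yD yz).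
    apply: contraLR zTD; rewrite negbK negb_or !negbK => -> /=.
    exact: comps_adj D0c (R0D0 _ _ DR0 yD) yz zM.
  have [|p3 c3] := packingU p1 p2.
    move=> P Q y /setD1P[PD0 Pc] QR yP; apply: contra PD0 => yQ; apply/eqP.
    exact: comps_eq Pc D0c yP (R0D0 _ _ QR yQ).
  have wS : w \in T :&: D0 by rewrite inE wT.
  have cS : #|S| = #|M| + #|T :&: D0|.
    apply: cardsU_disjoint => y yM; rewrite inE negb_and orbC.
    by apply/orP; left; apply/negP => /(comps_notin D0c); rewrite yM.
  have P1 : 0 < #|T :&: D0| by rewrite card_gt0; apply/set0Pn; exists w.
  have M2 := tight_gt1 tM.
  have lcS : #|M| + #|R0| <= #|comps adj S| .+1.
    have : #|comps adj M :\ D0 :|: R0| <= #|comps adj S| by apply: card_islands; case: p3.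
    have := cardsD1 D0 (comps adj M); rewrite D0c c3 (tight_card tM).
    by cardlia.
  rewrite leqNgt; apply/negP => lt.
  have le : #|comps adj S| <= #|S| by apply: tough1; move: lcS P1 M2 lt; cardlia.
  have tS : tight S.
    rewrite /tight eqn_leq le; apply/andP; split; first by move: cS M2; cardlia.
    by move: lcS lt cS; cardlia.
  have xS : [set x] \in comps adj S.
    apply: isolated_comp => [|y /NM yM]; first by rewrite SE xM xT.
    exact: (subsetP sMS).
  by have := maxM _ tS xS; rewrite cS; move: P1; cardlia.
have : #|[set y | adj x y]| <= #|t |: (T :&: M)|.
  apply/subset_leq_card/subsetP => y; rewrite inE => xy.
  rewrite !inE NM // andbT; exact: (lc_nb lc).
have := deg3 x; rewrite /degree cardsU1 => d3.
have : (t \notin T :&: M) <= 1 by case: (_ \notin _).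
move: d3 cJ cM lJ0 lJ1 cT cR lR1 cM2 lR0.
move: (nat_of_bool _) => b; cardlia.
Qed.

Section MaximalIsolating.
Variables (x : G) (M : {set G}).
Hypothesis maxM : max_isolating x M.

Let tM : tight M. Proof. by case: maxM. Qed.
Let xc : [set x] \in comps adj M. Proof. by case: maxM. Qed.
Let xM : x \notin M. Proof. by apply: (comps_notin xc); rewrite inE. Qed.

Let notadj y : y \notin M -> ~~ adj x y.
Proof. by apply: contra => /(isolated_adj xc). Qed.

(** Any other such c would be adjacent to everything beyond {x, t} + E by
    [complete_far]. *)
Lemma leaf_nbr_outside t T E c : leaf_cut x t T E -> adj t c -> c \notin M ->
  c = x \/ c \in E.
Proof.
move=> lc tc cM; have tZ : [|| t == x, t == t | t \in E] by rewrite eqxx orbT.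
have ct : c != t by rewrite eq_sym adj_neq.
have [cT|cT] := boolP (c \in T); last first.
  by have /or3P[/eqP|h|] := lc_zone_adj lc tZ tc cT; [left|rewrite h in ct|right].
have nxc := notadj cM; exfalso.
have T3 : 2 < #|T|.
  have : #|[set w | adj x w]| <= #|t |: (T :\ c)|.
    apply/subset_leq_card/subsetP => y; rewrite !inE => xy.
    have [//|yt] := eqVneq y t; rewrite (leaf_cut_adj lc xy yt) andbT.
    by apply: contraNneq nxc => <-.
  have := deg3 x; rewrite /degree cardsU1 (cardsD1 c T) cT; case: (_ \notin _); cardlia.
apply: (no_complete_outside maxM lc cT cM) => l lT lZ.
apply: (complete_far (lc_tight lc) T3 (lc_comp lc) _ _ (lc_adj lc) cT tc nxc lT);
  by rewrite lc_zoneE ?eqxx ?orbT.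
Qed.

(** For a neighbour y of e in T, the path x - t - e - y would be induced, and
    its domination would make y adjacent to everything beyond {x, t} + E. *)
Lemma leaf_zone_outside t T E e y : leaf_cut x t T E -> e \in E -> adj e y ->
  y \notin M -> y \in E.
Proof.
move=> lc eE ey yM; have eZ : [|| e == x, e == t | e \in E] by rewrite eE !orbT.
have nxe := lc_nxE lc eE; have nxy := notadj yM.
have tM' : t \in M := isolated_adj xc (lc_adj lc).
have [yT|yT] := boolP (y \in T); last first.
  have /or3P[/eqP h|/eqP h|//] := lc_zone_adj lc eZ ey yT.
    by rewrite -h adj_sym ey in nxe.
  by rewrite h tM' in yM.
exfalso; apply: (no_complete_outside maxM lc yT yM) => l lT lZ.
have nty : ~~ adj t y.
  apply/negP => ty; have [h|yE] := leaf_nbr_outside lc ty yM.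
    by move: yT; apply/negP; apply: (lc_zoneT lc); rewrite h eqxx.
  by move: yT; apply/negP; apply: (lc_zoneT lc); rewrite yE !orbT.
have nl z : [|| z == x, z == t | z \in E] -> adj l z = false.
  move=> zZ; apply: contraNF lZ; rewrite adj_sym => zl.
  exact: lc_zone_adj lc zZ zl lT.
have := domP4 l (lc_adj lc) (lc_E lc eE) ey nxe nxy nty.
by rewrite (nl x) ?(nl t) ?(nl e) ?eqxx ?eE ?orbT //= adj_sym.
Qed.

Definition inner E := [set D in comps adj M | ~~ [disjoint D & E]].

Lemma innerP E D : reflect (D \in comps adj M /\ exists2 y, y \in D & y \in E)
  (D \in inner E).
Proof.
rewrite inE; apply: (iffP andP) => -[Dc].
  by case/pred0Pn => y /andP[yD yE]; split=> //; exists y.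
by case=> y yD yE; split=> //; apply/pred0Pn; exists y; apply/andP.
Qed.

Lemma card_inner t T E : leaf_cut x t T E -> #|inner E| <= #|E :&: M|.+1.
Proof.
move=> lc; apply: (leaf_cut_inside lc) => [|D /innerP[Dc nz]].
  by apply/subsetP => D /innerP[].
apply: (comps_sub Dc nz) => y z yE yz zD.
exact: leaf_zone_outside lc yE yz (comps_notin Dc zD).
Qed.

Lemma touched_inner t T E A : leaf_cut x t T E -> A \subset E ->
  touched M A \subset inner E.
Proof.
move=> lc /subsetP AE; apply/subsetP => D /touchedP[Dc [y [a [yD aA ay]]]].
apply/innerP; split=> //; exists y => //.
exact: leaf_zone_outside lc (AE _ aA) ay (comps_notin Dc yD).
Qed.

Lemma touched_leaf t T E : leaf_cut x t T E ->
  touched M [set t] \subset [set x] |: inner E.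
Proof.
move=> lc; apply/subsetP => D /touchedP[Dc [y [a [yD /set1P -> ty]]]].
have [h|yE] := leaf_nbr_outside lc ty (comps_notin Dc yD); apply/setU1P.
  by left; apply: comps_eq Dc xc yD _; rewrite h inE.
by right; apply/innerP; split=> //; exists y.
Qed.

Lemma touchedU A B : touched M (A :|: B) = touched M A :|: touched M B.
Proof.
apply/setP => D; apply/touchedP/setUP => [[Dc [y [a [yD /setUP[aA|aB] ay]]]]|].
- by left; apply/touchedP; split=> //; exists y, a.
- by right; apply/touchedP; split=> //; exists y, a.
by case=> /touchedP[Dc [y [a [yD aA ay]]]]; split=> //; exists y, a;
  rewrite inE aA ?orbT.
Qed.

(** Let I1 and I2 be the parts of E1 and E2 in M.  The set {t1, t2} + I1 + I2
    touches only {x} and the inner components, but must touch more components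
    than it has vertices; t3 witnesses that it is not all of M.  Hence E1 and
    E2 share at most |I1 :&: I2| inner components, whereas I1 :&: I2, if
    nonempty, touches more than that. *)
Lemma inner_disjoint t1 T1 E1 t2 T2 E2 t3 : leaf_cut x t1 T1 E1 ->
  leaf_cut x t2 T2 E2 -> adj x t3 -> t1 != t2 -> t1 != t3 -> t2 != t3 ->
  inner E1 :&: inner E2 = set0.
Proof.
move=> lc1 lc2 xt3 t12 t13 t23.
have NE y : adj x y -> (y \notin E1) && (y \notin E2).
  by move=> xy; rewrite (contraL (lc_nxE lc1 (y := y))) ?(contraL (lc_nxE lc2 (y := y))) // negbK.
have [/andP[t1E1 t1E2] /andP[t2E1 t2E2] /andP[t3E1 t3E2]] :=
  And3 (NE _ (lc_adj lc1)) (NE _ (lc_adj lc2)) (NE _ xt3).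
have t1M := isolated_adj xc (lc_adj lc1); have t2M := isolated_adj xc (lc_adj lc2).
have t3M := isolated_adj xc xt3.
pose I1 := E1 :&: M; pose I2 := E2 :&: M.
pose A := [set t1; t2] :|: (I1 :|: I2).
have AM : A \proper M.
  rewrite properE; apply/andP; split.
    by rewrite !subUset !sub1set t1M t2M !subsetIr.
  apply/subsetPn; exists t3 => //.
  rewrite !inE !negb_or !(eq_sym t3) t13 t23 (negbTE t3E1) (negbTE t3E2) //.
have A0 : A != set0 by apply/set0Pn; exists t1; rewrite !inE eqxx.
have cA : #|A| = #|I1 :|: I2|.+2.
  rewrite (cardsU_disjoint (A := [set t1; t2])) ?cards2 ?t12 // => y /set2P[]->; rewrite !inE negb_or.
    by rewrite (negbTE t1E1) (negbTE t1E2).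
  by rewrite (negbTE t2E1) (negbTE t2E2).
have tA : touched M A \subset [set x] |: (inner E1 :|: inner E2).
  have [/subsetP s1 /subsetP s2] := (touched_leaf lc1, touched_leaf lc2).
  have /subsetP s3 := touched_inner lc1 (subsetIl E1 M).
  have /subsetP s4 := touched_inner lc2 (subsetIl E2 M).
  rewrite !touchedU; apply/subsetP => D /setUP[/setUP[/s1|/s2]|/setUP[/s3|/s4]];
    rewrite !in_setU; case: (D \in [set [set x]]); case: (D \in inner E1); case: (D \in inner E2) => //.
have := leq_trans (tight_touched tM A0 AM) (subset_leq_card tA).
have /leq_of_leqif := leq_card_setU [set [set x]] (inner E1 :|: inner E2).
rewrite cards1; have := cardsUI (inner E1) (inner E2); have := cardsUI I1 I2.
have := card_inner lc1; have := card_inner lc2; rewrite -/I1 -/I2 cA => h1 h2 h3 h4 h5 h6.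
have le : #|inner E1 :&: inner E2| <= #|I1 :&: I2| by move: h1 h2 h3 h4 h5 h6; cardlia.
have [I0|I0] := eqVneq (I1 :&: I2) set0.
  by apply/eqP; rewrite -cards_eq0; move: le; rewrite I0 cards0 leqn0.
have IM : I1 :&: I2 \proper M.
  rewrite properE subIset ?subsetIr //=; apply/subsetPn; exists t3 => //.
  by rewrite !inE (negbTE t3E1).
have := tight_touched tM I0 IM; rewrite ltnNge; case/negP; apply: leq_trans le.
apply/subset_leq_card; rewrite subsetI (touched_inner lc1) ?(touched_inner lc2) //.
  by rewrite subIset // subsetIl orbT.
by rewrite subIset // subsetIl.
Qed.

(** Neighbours e1, e2, e3 of three neighbours t1, t2, t3 of x, chosen outside M,
    are private.  Then e3 is not dominated by the path e1 - t1 - t2 - e2, or by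
    e1 - t1 - x - t2 if t1 and t2 are not adjacent. *)
Lemma max_isolating_absurd : False.
Proof.
have := deg3 x; rewrite /degree => /card_gt2P[t1 [t2 [t3 [[]]]]].
rewrite !inE => xt1 xt2 xt3 [t12 t23 t31].
have reg t : adj x t -> exists T E e, leaf_cut x t T E /\ [/\ e \in E, e \notin M & adj t e].
  move=> xt; have [T [E lc]] := isolated_leaf tM xc xt.
  have [e te /andP[eM ex]] := touch_other tM (isolated_adj xc xt) xc.
  exists T, E, e; split=> //; split=> //.
  by have [h|//] := leaf_nbr_outside lc te eM; rewrite h inE eqxx in ex.
have [T1 [E1 [e1 [lc1 [e1E e1M te1]]]]] := reg _ xt1.
have [T2 [E2 [e2 [lc2 [e2E e2M te2]]]]] := reg _ xt2.
have [T3 [E3 [e3 [lc3 [e3E e3M te3]]]]] := reg _ xt3.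
have sep E E' y : inner E :&: inner E' = set0 -> y \notin M -> y \in E ->
    y \in E' -> False.
  move=> dis yM yE yE'; have [D Dc yD] := comps_cover (@adj_sym G) yM.
  have /setP/(_ D) := dis; rewrite in_set0 in_setI.
  by case/negP; apply/andP; split; apply/innerP; split=> //; exists y.
have far t T E e t' T' E' e' t'' : leaf_cut x t T E -> leaf_cut x t' T' E' ->
    adj x t'' -> t != t' -> t != t'' -> t' != t'' -> e \in E -> e' \in E' ->
    e' \notin M -> ~~ adj t e' /\ ~~ adj e e'.
  move=> lc lc' xt'' tt' tt'' t't'' eE e'E e'M.
  have dis := inner_disjoint lc lc' xt'' tt' tt'' t't''.
  split; apply/negP => h; last exact: sep dis e'M (leaf_zone_outside lc eE h e'M) e'E.
  have [e'x|e'E2] := leaf_nbr_outside lc h e'M; last exact: sep dis e'M e'E2 e'E.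
  by have := lc_x lc'; rewrite -e'x e'E.
have t13 : t1 != t3 by rewrite eq_sym.
have t21 : t2 != t1 by rewrite eq_sym.
have t32 : t3 != t2 by rewrite eq_sym.
have [n12 m12] := far _ _ _ _ _ _ _ _ _ lc1 lc2 xt3 t12 t13 t23 e1E e2E e2M.
have [n21 m21] := far _ _ _ _ _ _ _ _ _ lc2 lc1 xt3 t21 t23 t13 e2E e1E e1M.
have [n13 m13] := far _ _ _ _ _ _ _ _ _ lc1 lc3 xt2 t13 t12 t32 e1E e3E e3M.
have [n23 m23] := far _ _ _ _ _ _ _ _ _ lc2 lc3 xt1 t23 t21 t31 e2E e3E e3M.
have [[x1 x2] x3] := (notadj e1M, notadj e2M, notadj e3M).
have [t12a|nt12] := boolP (adj t1 t2).
  have := domP4 e3 (adjC te1) t12a te2; rewrite ![adj _ t2]adj_sym ![adj _ t1]adj_sym.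
  rewrite (adj_sym e3 e1) (adj_sym e3 e2) n12 n21 m12 => /(_ isT isT isT).
  by rewrite (negbTE n13) (negbTE n23) (negbTE m13) (negbTE m23).
have := domP4 e3 (adjC te1) (adjC xt1) xt2; rewrite ![adj _ x]adj_sym (adj_sym e1 t2).
rewrite (adj_sym e3 e1) (adj_sym e3 t1) (adj_sym e3 t2) x1 n21 nt12 => /(_ isT isT isT).
by rewrite (negbTE m13) (negbTE n13) (negbTE x3) (negbTE n23).
Qed.

End MaximalIsolating.

Lemma min_degree3_absurd (x0 : G) : False.
Proof.
have [M0 [x [tM0 xM0]]] := tight_isolated_exists x0.
pose good M := tight M && ([set x] \in comps adj M).
have good0 : good M0 by rewrite /good tM0.
have [M /andP[tM xM] maxM] := arg_maxnP (fun M : {set G} => #|M|) good0.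
apply: (@max_isolating_absurd x M); split=> // M' tM' xM'.
by apply: maxM; rewrite /good tM'.
Qed.

End Core.
(** * Minimally 1-tough graphs *)

Section Toughness.
Variables (R : realType) (G : sgraph).
Implicit Types (S : {set G}) (v : G).

Lemma minimally_tough_noncomplete :
  minimally_tough (1%R : R) G -> ~~ complete G.
Proof. by case=> + _; rewrite /toughness; case: ifP. Qed.

Lemma minimally_tough_comps S : minimally_tough (1%R : R) G ->
  1 < #|comps adj S| -> #|comps adj S| <= #|S|.
Proof.
move=> mt; have [t [eT _ toughT _]] :=
  @toughness_attained R G (minimally_tough_noncomplete mt).
case: mt; rewrite eT => -[t1] _; rewrite -connected_comps => /toughT.
by rewrite t1 mul1r -card_comps ler_nat.
Qed.

Lemma minimally_tough_edge u v : minimally_tough (1%R : R) G -> adj u v ->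
  exists S, 1 < #|comps (del_edge_rel u v) S| /\
            #|S| < #|comps (del_edge_rel u v) S|.
Proof.
case=> _ /(_ u v) crit /crit; set H := del_edge u v => lt1.
have [/existsP[S /andP[S1 S2]]|no] := boolP [exists S : {set H},
  (1 < #|comps (@adj H) S|) && (#|S| < #|comps (@adj H) S|)]; first by exists S.
have ncH : ~~ complete H by apply: contraTN lt1; rewrite /toughness => ->.
have [t [eT _ _ maxT]] := @toughness_attained R H ncH.
suff : (1 <= t)%R by rewrite leNgt -lte_fin -eT lt1.
apply: maxT => // S; rewrite /vertex_cut connected_comps mul1r -card_comps ler_nat => S1.
by rewrite leqNgt; apply: contra no => S2; apply/existsP; exists S; rewrite S1.
Qed.

(** With fewer than two neighbours, v is cut off by them from any vertex that is
    not adjacent to v; without such a vertex the graph is complete. *)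
Lemma minimally_tough_degree v : minimally_tough (1%R : R) G -> 2 <= degree v.
Proof.
move=> mt; rewrite leqNgt; apply/negP => d1.
have /negP := minimally_tough_noncomplete mt; apply.
pose N := [set w | adj v w]; have NP w : (w \in N) = adj v w by rewrite inE.
have all w : w != v -> adj v w.
  move=> wv; apply: contraT => nvw; suff : 1 < #|N| by rewrite ltnNge -ltnS d1.
  have tough S := @minimally_tough_comps S mt.
  apply: (@two_islands G tough N [set v] (~: (v |: N)) v w).
  - apply/islandP; split=> [|x|x y]; first by exists v; rewrite inE.
      by move=> /set1P ->; rewrite NP adj_irr.
    by move=> /set1P -> vy; rewrite NP vy.
  - apply/islandP; split=> [|x|x y].
    + by exists w; rewrite !inE negb_or wv.
    + by rewrite !inE negb_or => /andP[].
    rewrite !inE !negb_or => /andP[xv nvx] xy nvy; rewrite nvy andbT.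
    by apply: contraNneq nvx => <-; rewrite adj_sym.
  - by rewrite inE.
  - by rewrite !inE negb_or wv.
  - by move=> x /set1P ->; rewrite !inE eqxx.
apply/forallP => x; apply/forallP => y; apply/implyP => xy.
have [ev|xv] := eqVneq x v; first by rewrite ev all // -ev eq_sym.
have [ev|yv] := eqVneq y v; first by rewrite ev adj_sym all.
move: d1; rewrite ltnS leqNgt; case/negP; apply/card_gt1P; exists x, y; split=> //.
  by rewrite inE all.
by rewrite inE all.
Qed.
End Toughness.

Theorem corollary1p8 (R : realType) (G : sgraph) :
  minimally_tough (1%R : R) G ->
  induced_free (disjoint_union (complete_graph 1) (path_graph 4)) G ->
  min_degree G = 2.
Proof.
move=> mt free.
have [x0 _] : exists x : G, true.
  have := minimally_tough_noncomplete mt; rewrite negb_forall => /existsP[x _].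
  by exists x.
have [v ev] := min_degree_attained x0; rewrite -ev.
apply/eqP; rewrite eqn_leq (minimally_tough_degree v mt) andbT leqNgt ev.
apply/negP => d3; apply: (@min_degree3_absurd G _ _ _ _ x0).
- by move=> S; apply: (@minimally_tough_comps R).
- by move=> z a b c d; apply: dominated_P4.
- by move=> w; apply: leq_trans d3 (min_degree_le w).
- by move=> u w; apply: (@minimally_tough_edge R).
Qed.
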